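(* Let $\mathbb{K}=\mathbb{R}$ or $\mathbb{C}$, $d\ge1$, and let $\mathcal{M}\subseteq\mathbb{K}^{d\times d}$ be nonempty, compact and of reducibility index $m\ge1$. Let $V$ be a linear subspace of $\mathbb{K}^{d\times d}$, let $\|\cdot\|$ be a norm on $\mathbb{K}^{d\times d}$ (not necessarily a matrix norm), let $\mathcal{B}_V=\{A\in V : \|A\|\le1\}$, and set $\mathcal{M}_\varepsilon:=\mathcal{M}+\varepsilon\mathcal{B}_V=\{A+\varepsilon B : A\in\mathcal{M}, B\in\mathcal{B}_V\}$ for $\varepsilon\ge0$. Then the map $r:[0,\infty)\to\mathbb{R}$, $r(\varepsilon):=\rho(\mathcal{M}_\varepsilon)$, is locally $\frac{1}{m+1}$-Hölder continuous if $m\ge2$, and locally Lipschitz continuous if $m=1$.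
   Context: The joint spectral radius of a nonempty compact set $\mathcal{N}\subseteq\mathbb{K}^{d\times d}$ is $\rho(\mathcal{N})=\lim_{k\to\infty}\sup\{\|S\| : S\in\mathcal{S}_k(\mathcal{N})\}^{1/k}$ with $\mathcal{S}_k(\mathcal{N})=\{A_{k-1}\cdots A_0 : A_j\in\mathcal{N}\}$ and any operator norm $\|\cdot\|$. The reducibility index of $\mathcal{M}$ is the length $m$ of a maximal flag $\{0\}=F_0\subsetneq F_1\subsetneq\cdots\subsetneq F_m=\mathbb{K}^d$ of subspaces each of which is $A$-invariant for all $A\in\mathcal{M}$ (so $m=1$ means $\mathcal{M}$ is irreducible). A function $f:X\to Z$ between metric spaces is locally Hölder continuous with exponent $\alpha$ if for every compact $K\subseteq X$, $\sup_{x\ne y\in K}d_Z(f(x),f(y))/d_X(x,y)^\alpha<\infty$. Locally Lipschitz is the case $\alpha=1$. *)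

(* Defs.v *)
From HB Require Import structures.
From mathcomp Require Import all_boot all_order all_algebra.
From mathcomp Require Import all_classical all_reals all_analysis.
From mathcomp Require Import complex.

Set Implicit Arguments.
Unset Strict Implicit.
Unset Printing Implicit Defensive.

Import Order.TTheory GRing.Theory Num.Theory.
Import numFieldNormedType.Exports.

Local Open Scope classical_set_scope.
Local Open Scope ring_scope.

(* [real_or_complex iota absK] says that the scalar field K is R or R[i].
   MathComp norms on K take their values in K itself, so K comes with the
   embedding [iota] of the reals and with its real-valued absolute value
   [absK]; they satisfy iota (absK z) = `|z|. *)
Variant real_or_complex (R : realType) :
    forall K : numFieldType, (R -> K) -> (K -> R) -> Prop :=
| scalars_real : @real_or_complex R R (fun x => x) (fun x => `|x|)
| scalars_complex :
    @real_or_complex R R[i] (@real_complex R) (@ComplexField.Normc.normc R).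

Section JointSpectralRadius.
Context (R : realType) (K : numFieldType).
Implicit Types (iota : R -> K) (absK : K -> R) (d : nat).

Definition is_norm absK (E : lmodType K) (N : E -> R) : Prop :=
  [/\ forall x, 0 <= N x,
      forall x, N x = 0 -> x = 0,
      forall (a : K) x, N (a *: x) = absK a * N x
    & forall x y, N (x + y) <= N x + N y].

Definition operator_norm d (nu : 'cV[K]_d -> R) (A : 'M[K]_d) : R :=
  sup [set nu (A *m x) | x in [set x | nu x <= 1]].

(* \prod multiplies from left to right, whence [rev_ord]: the product is
   A_(k-1) * ... * A_0. *)
Definition products d (N : set 'M[K]_d) (k : nat) : set 'M[K]_d :=
  [set S | exists2 A : 'I_k -> 'M[K]_d,
     (forall j, N (A j)) & S = \prod_(i < k) A (rev_ord i)].

Definition joint_spectral_radius d (nu : 'cV[K]_d -> R) (N : set 'M[K]_d) : R :=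
  lim ((fun k : nat =>
    sup [set operator_norm nu S | S in products N k] `^ (k%:R^-1)) @ \oo).

Definition perturbed iota d (M : set 'M[K]_d) (V : {vspace 'M[K]_d})
    (N : 'M[K]_d -> R) (eps : R) : set 'M[K]_d :=
  [set A + iota eps *: B | A in M & B in [set B | B \in V /\ N B <= 1]].

Definition invariant_subspace d (M : set 'M[K]_d) (U : {vspace 'cV[K]_d}) :
    Prop :=
  forall A, M A -> forall x, x \in U -> A *m x \in U.

(* Only the values F 0, ..., F m matter. *)
Definition invariant_flag d (M : set 'M[K]_d) (m : nat)
    (F : nat -> {vspace 'cV[K]_d}) : Prop :=
  [/\ F 0%N = 0%VS, F m = fullv,
      forall i, (i < m)%N -> (F i <= F i.+1)%VS /\ F i != F i.+1
    & forall i, (i <= m)%N -> invariant_subspace M (F i)].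

(* Maximality is with respect to refinement: the members of a flag being
   pairwise distinct, a refinement is proper iff it is longer. *)
Definition maximal_invariant_flag d (M : set 'M[K]_d) (m : nat)
    (F : nat -> {vspace 'cV[K]_d}) : Prop :=
  invariant_flag M m F /\
  forall (n : nat) (G : nat -> {vspace 'cV[K]_d}), invariant_flag M n G ->
    (forall i, (i <= m)%N -> exists2 j, (j <= n)%N & G j = F i) -> n = m.

(* By the Jordan-Hoelder theorem, all maximal flags have the same length. *)
Definition reducibility_index d (M : set 'M[K]_d) (m : nat) : Prop :=
  exists F, maximal_invariant_flag M m F.

End JointSpectralRadius.

(* Local Hoelder continuity of f on the metric subspace D of X; a subset of D
   is compact in D iff it is compact in X.  The supremum is taken in \bar R;
   over the empty set it is -oo. *)
Definition locally_holder (R : realType) (X Z : metricType R) (D : set X)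
    (alpha : R) (f : X -> Z) : Prop :=
  forall C : set X, compact C -> C `<=` D ->
    (ereal_sup [set (mdist (f p.1) (f p.2) / mdist p.1 p.2 `^ alpha)%:E
               | p in [set p : X * X | [/\ C p.1, C p.2 & p.1 != p.2]]]
      < +oo)%E.

Definition locally_lipschitz (R : realType) (X Z : metricType R) (D : set X)
    (f : X -> Z) : Prop :=
  locally_holder D 1 f.

(* Main.v *)
Require Import Defs.
From HB Require Import structures.
From mathcomp Require Import all_boot all_order all_algebra.
From mathcomp Require Import all_classical all_reals all_analysis.
From mathcomp Require Import complex ring lra.

Set Implicit Arguments.
Unset Strict Implicit.
Unset Printing Implicit Defensive.

Import Order.TTheory GRing.Theory Num.Theory.
Import numFieldNormedType.Exports.

Local Open Scope classical_set_scope.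
Local Open Scope ring_scope.

(** For a nonempty bounded set P of matrices, the joint spectral radius is the
    infimum of the rates l for which some norm w satisfies w(A x) <= l w(x) for
    all A in P and all x (jsrE).  Upper bounds on r(e) = rho(M_e) are therefore
    obtained by exhibiting norms, and a value of r is used through a norm that
    nearly realizes it.  Write e < e' for two parameters.  As r is
    nondecreasing, only r(e') - r(e) has to be bounded from above.

    Away from 0, both A + e B and A - e B lie in M_e.  A norm w contracted at
    rate l by M_e thus satisfies e w(B x) <= l w(x), and M_e' is contracted at
    rate l + (e' - e) l / e.  Hence r(e') - r(e) <= (e' - e) / e * r(e)
    (perturbed_ratio).

    Near 0, let F be a maximal invariant flag of length m.  Irreducibility of
    each quotient F_(i+1) / F_i makes the eccentricity of its seminorms bounded
    in terms of their growth rate alone (eccentricity_bound).  Take a norm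
    contracted by M at a rate close to r(0), and add up its normalized quotient
    seminorms, read on the components along complements of the F_i, with weights
    eta^(-i), for 0 < eta <= 1.  The blocks of M above the diagonal
    become of order eta, while an arbitrary matrix is magnified by at most
    eta^(1-m) (adapted_norm).  So r(e) <= r(0) + O(eta) as soon as
    e = O(eta^m) (jsr_holder_at0).

    Let theta^(m+1) = e' - e.  If e <= theta^m, the second estimate with
    eta = theta gives an increment O(theta); otherwise (e' - e) / e <= theta and
    the first one does (holder_of_ratio).  This is the exponent 1/(m+1).

    When M is irreducible, the norms contracted by M_e at rate at most L are all
    contracted by M, so they have a common eccentricity bound; the directions B
    have bounded size in each of them, whence r(e') - r(e) <= C (e' - e) with C
    uniform on bounded sets of parameters (jsr_lipschitz_irreducible). *)

(** * Scalars *)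

(** What the proof needs to know about the scalars, so that the real and the
    complex case are treated at once. *)
Record scalar_theory (R : realType) (K : numFieldType)
    (iota : R -> K) (absK : K -> R) : Prop := ScalarTheory {
  iota1 : iota 1 = 1;
  iotaB : forall x y, iota (x - y) = iota x - iota y;
  iotaM : forall x y, iota (x * y) = iota x * iota y;
  iota_gt0 : forall x, 0 < x -> 0 < iota x;
  abs_iota : forall x, absK (iota x) = `|x|;
  abs_ge0 : forall z, 0 <= absK z;
  abs0_eq0 : forall z, absK z = 0 -> z = 0;
  absM : forall z w, absK (z * w) = absK z * absK w;
  absD : forall z w, absK (z + w) <= absK z + absK w;
  lt_norm_abs : forall z e, (`|z| < iota e) = (absK z < e);
  bounded_in_compact : forall c,
    exists2 D : set K, compact D & forall z, absK z <= c -> D z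
}.

Lemma scalar_theoryP (R : realType) (K : numFieldType)
    (iota : R -> K) (absK : K -> R) :
  real_or_complex iota absK -> scalar_theory iota absK.
Proof.
case.
  split=> //=; [exact: normr0_eq0 | exact: normrM | exact: ler_normD |].
  move=> c; exists `[- c, c]%classic; first exact: segment_compact.
  by move=> z; rewrite ler_norml /= in_itv.
have normc_re (x : R) : ComplexField.Normc.normc (x%:C)%C = `|x|.
  by rewrite /= expr0n addr0 sqrtr_sqr.
split.
- by [].
- by move=> x y; rewrite raddfB.
- by move=> x y; rewrite rmorphM.
- by move=> x x0; rewrite ltcR.
- exact: normc_re.
- by case=> a b; rewrite /= sqrtr_ge0.
- exact: ComplexField.Normc.eq0_normc.
- exact: ComplexField.Normc.normcM.
- exact: le_normcD.
- by move=> [a b] e; rewrite normc_def ltcR.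
move=> c.
(* The disc of radius c is contained in the square of half-side c. *)
pose f (p : R * R) : R[i] := (p.1 +i* p.2)%C.
exists (f @` (`[- c, c]%classic `*` `[- c, c]%classic)); last first.
  move=> [a b] /= h; exists (a, b) => //=; rewrite !in_itv /= -!ler_norml.
  split; apply: (le_trans _ h); rewrite -sqrtr_sqr ler_wsqrtr //.
    by rewrite lerDl sqr_ge0.
  by rewrite lerDr sqr_ge0.
apply: continuous_compact; last by apply: compact_setX; exact: segment_compact.
apply: continuous_subspaceT => -[a b].
move=> A /nbhs_ballP[[e e'] /= e0 hA].
have [e'0 {}e0] : e' = 0 /\ 0 < e by move: e0; rewrite ltcE /= => /andP[/eqP].
apply/nbhs_ballP; exists (e / 2) => /=; first by rewrite divr_gt0.
move=> [x y] [/= hx hy]; apply: hA; rewrite /ball /= e'0 normc_def /= ltcR.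
move: hx hy; rewrite /ball /= !ltr_norml => /andP[h1 h2] /andP[h3 h4].
rewrite -[ltRHS]ger0_norm ?(ltW e0)// -sqrtr_sqr ltr_sqrt ?exprn_gt0//.
nra.
Qed.

(** * Seminorms on spaces of matrices *)

Section Seminorms.
Context (R : realType) (K : numFieldType) (iota : R -> K) (absK : K -> R).
Context (KT : scalar_theory iota absK).

Lemma iota0 : iota 0 = 0.
Proof. by rewrite -(subrr 0) (iotaB KT) subrr. Qed.

Lemma iota_double x : iota x + iota x = iota (x *+ 2).
Proof.
rewrite mulr2n -[X in iota (_ + X)]opprK (iotaB KT) -[- x]sub0r (iotaB KT).
by rewrite iota0 sub0r opprK.
Qed.

Lemma abs0 : absK 0 = 0.
Proof. by rewrite -iota0 (abs_iota KT) normr0. Qed.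

Lemma abs1 : absK 1 = 1.
Proof. by rewrite -(iota1 KT) (abs_iota KT) normr1. Qed.

Lemma absN1 : absK (- 1) = 1.
Proof.
by rewrite -(iota1 KT) -[- _]sub0r -iota0 -(iotaB KT) (abs_iota KT) sub0r
  normrN1.
Qed.

Lemma abs_gt0 z : z != 0 -> 0 < absK z.
Proof.
move=> z0; rewrite lt_neqAle (abs_ge0 KT) andbT eq_sym.
by apply: contra z0 => /eqP/(abs0_eq0 KT) ->.
Qed.

Definition is_seminorm (E : lmodType K) (p : E -> R) : Prop :=
  [/\ forall x, 0 <= p x,
      forall (a : K) x, p (a *: x) = absK a * p x
    & forall x y, p (x + y) <= p x + p y].

Lemma norm_is_seminorm (E : lmodType K) (p : E -> R) :
  is_norm absK p -> is_seminorm p.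
Proof. by case. Qed.

Section Basics.
Context (E : lmodType K) (p : E -> R) (hp : is_seminorm p).

Lemma seminorm_ge0 x : 0 <= p x. Proof. by case: hp. Qed.

Lemma seminormZ a x : p (a *: x) = absK a * p x. Proof. by case: hp. Qed.

Lemma seminormD x y : p (x + y) <= p x + p y. Proof. by case: hp. Qed.

Lemma seminorm0 : p 0 = 0.
Proof. by rewrite -(scale0r 0) seminormZ abs0 mul0r. Qed.

Lemma seminormN x : p (- x) = p x.
Proof. by rewrite -scaleN1r seminormZ absN1 mul1r. Qed.

Lemma seminormB x y : p (x - y) <= p x + p y.
Proof. by rewrite -(seminormN y) seminormD. Qed.

Lemma seminorm_le_distl x y : p x <= p y + p (x - y).
Proof. by apply: le_trans (seminormD _ _); rewrite subrKC. Qed.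

Lemma seminorm_sum I (r : seq I) (P : pred I) (F : I -> E) :
  p (\sum_(i <- r | P i) F i) <= \sum_(i <- r | P i) p (F i).
Proof.
elim/big_rec2: _ => [|i y1 y2 _ h]; first by rewrite seminorm0.
by apply: le_trans (seminormD _ _) _; rewrite lerD2l.
Qed.

End Basics.

Lemma seminorm_zero (E : lmodType K) : is_seminorm (fun _ : E => 0).
Proof. by split=> *; rewrite ?mulr0 ?addr0. Qed.

Lemma seminorm_comp (E F : lmodType K) (f : {linear E -> F}) (p : F -> R) :
  is_seminorm p -> is_seminorm (p \o f).
Proof.
move=> hp; split=> [x|a x|x y] /=; first exact: seminorm_ge0.
  by rewrite linearZ /= seminormZ.
by rewrite raddfD seminormD.
Qed.

Lemma seminorm_add (E : lmodType K) (p q : E -> R) :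
  is_seminorm p -> is_seminorm q -> is_seminorm (fun x => p x + q x).
Proof.
move=> hp hq; split=> [x|a x|x y]; first by rewrite addr_ge0 ?seminorm_ge0.
  by rewrite !seminormZ// mulrDr.
by rewrite addrACA lerD ?seminormD.
Qed.

Lemma seminorm_scale (E : lmodType K) (p : E -> R) c : 0 <= c ->
  is_seminorm p -> is_seminorm (fun x => c * p x).
Proof.
move=> c0 hp; split=> [x|a x|x y]; first by rewrite mulr_ge0 ?seminorm_ge0.
  by rewrite seminormZ// mulrCA.
by rewrite -mulrDr ler_wpM2l ?seminormD.
Qed.

(** Homogeneity only has to be checked as an inequality, because the scalar
    can be inverted. *)
Lemma seminorm_of_le (E : lmodType K) (p : E -> R) :
  (forall x, 0 <= p x) -> (forall a x, p (a *: x) <= absK a * p x) ->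
  (forall x y, p (x + y) <= p x + p y) -> is_seminorm p.
Proof.
move=> p0 pZ pD; split=> // a x; apply/eqP; rewrite eq_le pZ /=.
have [->|a0] := eqVneq a 0; first by rewrite abs0 mul0r.
rewrite -[X in _ * p X]scale1r -(mulVf a0) -scalerA.
have a1 : absK a * absK a^-1 = 1 by rewrite -(absM KT) mulfV// abs1.
rewrite -[leRHS]mul1r -a1 -mulrA ler_wpM2l ?(abs_ge0 KT)//.
Qed.

Lemma seminorm_sup (E : lmodType K) I (D : set I) (p : I -> E -> R) :
  D !=set0 -> (forall i, D i -> is_seminorm (p i)) ->
  (forall x, has_ubound [set p i x | i in D]) ->
  is_seminorm (fun x => sup [set p i x | i in D]).
Proof.
move=> [i0 Di0] hp hb.
have ne x : [set p i x | i in D] !=set0 by exists (p i0 x), i0.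
have le_s i x : D i -> p i x <= sup [set p i x | i in D].
  by move=> Di; apply: ub_le_sup => //; exists i.
apply: seminorm_of_le => [x|a x|x y].
- by apply: le_trans (le_s i0 x Di0); exact: seminorm_ge0 (hp _ Di0) _.
- apply: ge_sup => // _ [i Di <-]; rewrite (seminormZ (hp _ Di)).
  by rewrite ler_wpM2l ?(abs_ge0 KT) ?le_s.
- apply: ge_sup => // _ [i Di <-]; apply: le_trans (seminormD (hp _ Di) _ _) _.
  by rewrite lerD ?le_s.
Qed.

(** ** The reference norm *)

Definition absmx m n (A : 'M[K]_(m, n)) : R := \sum_i \sum_j absK (A i j).

Lemma absmx_norm m n : is_norm absK (@absmx m n).
Proof.
have A0 (A : 'M[K]_(m, n)) i : 0 <= \sum_j absK (A i j).
  by apply: sumr_ge0 => *; exact: abs_ge0 KT _.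
split=> [A|A|a A|A B].
- by apply: sumr_ge0.
- move=> /eqP; rewrite psumr_eq0 // => /allP h; apply/matrixP => i j.
  have := h i (mem_index_enum _); rewrite psumr_eq0 => [/allP h'|*]; last first.
    exact: abs_ge0 KT _.
  by have /eqP/(abs0_eq0 KT) -> := h' j (mem_index_enum _); rewrite mxE.
- rewrite /absmx mulr_sumr; apply: eq_bigr => i _; rewrite mulr_sumr.
  by apply: eq_bigr => j _; rewrite mxE (absM KT).
- rewrite /absmx -big_split; apply: ler_sum => i _; rewrite -big_split.
  by apply: ler_sum => j _; rewrite mxE (absD KT).
Qed.

Lemma absmx_seminorm m n : is_seminorm (@absmx m n).
Proof. exact: norm_is_seminorm (absmx_norm m n). Qed.

Lemma absmx_ge0 m n (A : 'M[K]_(m, n)) : 0 <= absmx A.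
Proof. exact: seminorm_ge0 (absmx_seminorm m n) A. Qed.

Lemma absmx_gt0 m n (A : 'M[K]_(m, n)) : A != 0 -> 0 < absmx A.
Proof.
move=> A0; rewrite lt_neqAle absmx_ge0 andbT eq_sym.
by case: (absmx_norm m n) => _ h _ _; apply: contra A0 => /eqP/h ->.
Qed.

(** Expand A in the basis of elementary matrices. *)
Lemma seminorm_bounded m n (p : 'M[K]_(m, n) -> R) : is_seminorm p ->
  exists2 C, 0 < C & forall A, p A <= C * absmx A.
Proof.
move=> hp; pose C := 1 + \sum_i \sum_j p (delta_mx i j).
have S0 : 0 <= \sum_i \sum_j p (delta_mx i j).
  by apply: sumr_ge0 => i _; apply: sumr_ge0 => j _; exact: seminorm_ge0.
exists C => [|A]; first by rewrite ltr_pwDl.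
rewrite {1}(matrix_sum_delta A) mulr_sumr.
apply: le_trans (seminorm_sum hp _ _ _) _; apply: ler_sum => i _.
rewrite mulr_sumr; apply: le_trans (seminorm_sum hp _ _ _) _.
apply: ler_sum => j _; rewrite (seminormZ hp) mulrC.
rewrite ler_wpM2r ?(abs_ge0 KT)// /C.
rewrite (bigD1 i)//= (bigD1 (P := xpredT) j)//=.
have h1 : 0 <= \sum_(k < n | k != j) p (delta_mx i k).
  by apply: sumr_ge0 => k _; exact: seminorm_ge0.
have h2 : 0 <= \sum_(k < m | k != i) \sum_(l < n) p (delta_mx k l).
  by apply: sumr_ge0 => k _; apply: sumr_ge0 => l _; exact: seminorm_ge0.
by move: h1 h2; lra.
Qed.

Lemma linear_bounded m n m' n' (f : {linear 'M[K]_(m, n) -> 'M[K]_(m', n')}) :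
  exists2 C, 0 < C & forall A, absmx (f A) <= C * absmx A.
Proof. exact: seminorm_bounded (seminorm_comp f (absmx_seminorm m' n')). Qed.

Lemma nbhs_absmx m n (A : 'M[K]_(m, n)) e : 0 < e ->
  nbhs A [set B | absmx (B - A) < e].
Proof.
move=> e0; pose d := e / (m * n).+1%:R.
have d0 : 0 < d by rewrite divr_gt0.
apply/nbhs_ballP; exists (iota d) => /=; first exact: iota_gt0 KT _ d0.
move=> B [_ hB] /=; apply: le_lt_trans (_ : (m * n)%:R * d < _).
  apply: le_trans (_ : \sum_(i < m) \sum_(j < n) d <= _).
    apply: ler_sum => i _; apply: ler_sum => j _.
    by rewrite !mxE ltW// -(lt_norm_abs KT) distrC; exact: hB.
  by rewrite !sumr_const !card_ord -mulrnA mulr_natl mulnC.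
by rewrite /d mulrCA gtr_pMr// ltr_pdivrMr// mul1r ltr_nat.
Qed.

(** ** Compactness of the unit sphere *)

(** Compactness of the unit sphere in covering form.  The points of the
    bounded set that is covered may lie off the sphere, but those near 0 impose
    nothing on Q. *)
Lemma sphere_uniform m n (Q : R -> 'M[K]_(m, n) -> Prop) :
  (forall c c' A, c <= c' -> Q c A -> Q c' A) ->
  (forall A0, A0 != 0 -> exists2 e, 0 < e &
     exists c, forall A, absmx (A - A0) < e -> Q c A) ->
  exists c, forall A, absmx A = 1 -> Q c A.
Proof.
move=> Qmono Qloc.
have [D Dc hD] := bounded_in_compact KT 1.
have := rV_compact (fun _ : 'I_(m * n) => Dc).
rewrite compact_near_coveringP => cov.
pose P c (v : 'rV[K]_(m * n)) := absmx (vec_mx v) = 1 -> Q c (vec_mx v).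
have nb e (v : 'rV[K]_(m * n)) : 0 < e ->
    nbhs v [set v' | absmx (vec_mx v' - vec_mx v) < e].
  move=> e0; have [C C0 hC] := linear_bounded (@vec_mx K m n).
  apply: filterS (nbhs_absmx v (divr_gt0 e0 C0)) => v' /=.
  by rewrite ltr_pdivlMr// mulrC -linearB; exact: le_lt_trans (hC _).
have [|c [_ hc]] := cov R (+oo%R)%classic P _ _.
  move=> v _; have [v0|v0] := eqVneq (vec_mx v) 0.
    exists ([set v' | absmx (vec_mx v' - vec_mx v) < 1], setT) => /=.
      by split; [exact: nb | exact: filterT].
    move=> [v' c] [/= + _]; rewrite v0 subr0 => h1 h2.
    by move: h1; rewrite h2 ltxx.
  have [e e0 [c hc]] := Qloc _ v0.
  exists ([set v' | absmx (vec_mx v' - vec_mx v) < e], [set c' | c < c']) => /=.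
    by split; [exact: nb | apply: nbhs_pinfty_gt; exact: num_real].
  move=> [v' c'] [/= h1 h2] _; apply: Qmono (ltW h2) _; exact: hc.
exists (c + 1) => A A1; have := hc (c + 1) _ (mxvec A); rewrite /P mxvecK.
apply=> //; first by rewrite ltrDl.
move=> k /=; apply: hD; case/mxvec_indexP: k => i j; rewrite mxvecE -A1.
rewrite /absmx (bigD1 i)//= (bigD1 (P := xpredT) j)//= -addrA lerDl addr_ge0//.
  by apply: sumr_ge0 => l _; exact: abs_ge0 KT _.
by apply: sumr_ge0 => k _; apply: sumr_ge0 => l _; exact: abs_ge0 KT _.
Qed.

Lemma absmx_normalize m n (A : 'M[K]_(m, n)) : A != 0 ->
  absmx (iota (absmx A)^-1 *: A) = 1.
Proof.
move=> /absmx_gt0 A0; rewrite (seminormZ (absmx_seminorm m n)) (abs_iota KT).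
by rewrite ger0_norm ?invr_ge0 ?ltW// mulVf// gt_eqF.
Qed.

(** All norms are equivalent: around A0 <> 0 the norm w stays above w(A0)/2,
    and compactness makes the resulting constant uniform. *)
Lemma norm_lower_bound m n (w : 'M[K]_(m, n) -> R) : is_norm absK w ->
  exists2 C, 0 < C & forall A, absmx A <= C * w A.
Proof.
move=> hw; have sw := norm_is_seminorm hw.
have [B B0 hB] := seminorm_bounded sw.
have [|A0 A00|c hc] := @sphere_uniform m n (fun c A => absmx A <= c * w A).
- move=> c c' A cc' h; apply: le_trans h _.
  by rewrite ler_wpM2r ?(seminorm_ge0 sw).
- have w0 : 0 < w A0.
    rewrite lt_neqAle (seminorm_ge0 sw) andbT eq_sym.
    by case: hw => _ h _ _; apply: contra A00 => /eqP/h ->.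
  exists (w A0 / (2 * B)); first by rewrite divr_gt0// mulr_gt0.
  exists ((absmx A0 + w A0 / (2 * B)) * (2 / w A0)) => A hA.
  have h1 : absmx A <= absmx A0 + w A0 / (2 * B).
    apply: le_trans (seminorm_le_distl (absmx_seminorm m n) _ A0) _.
    by rewrite lerD2l ltW.
  have h2 : 1 <= 2 / w A0 * w A.
    rewrite mulrAC ler_pdivlMr// mul1r.
    have := seminorm_le_distl sw A0 A; rewrite -(seminormN sw (A0 - A)) opprB.
    have := hB (A - A0); move: hA; rewrite ltr_pdivlMr ?mulr_gt0// mulrCA.
    by rewrite [absmx _ * B]mulrC; lra.
  apply: le_trans h1 _; rewrite -mulrA ler_peMr// addr_ge0 ?absmx_ge0//.
  by rewrite ltW// divr_gt0// mulr_gt0.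
exists (`|c| + 1) => [|A]; first by rewrite ltr_wpDl.
have [->|A0] := eqVneq A 0.
  by rewrite (seminorm0 sw) (seminorm0 (absmx_seminorm _ _)) mulr0.
have A0' := absmx_gt0 A0.
have := hc _ (absmx_normalize A0); rewrite absmx_normalize// (seminormZ sw).
rewrite (abs_iota KT) ger0_norm ?invr_ge0 ?absmx_ge0// mulrCA mulrC.
rewrite ler_pdivlMr// mul1r => /le_trans; apply.
rewrite ler_wpM2r ?(seminorm_ge0 sw)//.
by rewrite (le_trans (ler_norm c))// lerDl.
Qed.

Lemma compact_absmx_bounded m n (M : set 'M[K]_(m, n)) : compact M ->
  exists2 C, 0 < C & forall A, M A -> absmx A <= C.
Proof.
rewrite compact_near_coveringP => cov.
have [|c [_ hc]] := cov R (+oo%R)%classic (fun c A => absmx A <= c) _ _.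
  move=> A _; exists ([set B | absmx (B - A) < 1], [set c | absmx A + 1 < c]).
    by split; [exact: nbhs_absmx | apply: nbhs_pinfty_gt; exact: num_real].
  move=> [B c] [/= hb hc]; apply: le_trans (ltW hc).
  apply: le_trans (seminorm_le_distl (absmx_seminorm m n) _ A) _.
  by rewrite lerD2l ltW.
exists (`|c| + 1) => [|A MA]; first by rewrite ltr_wpDl.
by apply: hc => //; rewrite (le_lt_trans (ler_norm c))// ltrDl.
Qed.

End Seminorms.

(** * The joint spectral radius as an infimum over norms *)

Section Jsr.
Context (R : realType) (K : numFieldType) (iota : R -> K) (absK : K -> R).
Context (KT : scalar_theory iota absK).
Context (d : nat).
Implicit Types (N : set 'M[K]_d) (A : 'M[K]_d) (x : 'cV[K]_d).

Lemma sup_nonneg (S : set R) : (forall c, S c -> 0 <= c) -> 0 <= sup S.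
Proof.
move=> S0; have [hS|/sup_out -> //] := pselect (has_sup S).
have [[c Sc] ub] := hS.
by apply: le_trans (S0 c Sc) _; exact: ub_le_sup.
Qed.

Lemma absmx_mul A x : absmx absK (A *m x) <= absmx absK A * absmx absK x.
Proof.
have le_x j : absK (x j 0) <= absmx absK x.
  rewrite /absmx (bigD1 j)//= big_ord1 lerDl.
  by apply: sumr_ge0 => k _; rewrite big_ord1 (abs_ge0 KT).
rewrite {1 2}/absmx mulr_suml; apply: ler_sum => i _.
rewrite big_ord1 mulr_suml.
rewrite mxE; elim/big_rec2: _ => [|j y1 y2 _ h]; first by rewrite (abs0 KT).
apply: le_trans (absD KT _ _) _; rewrite lerD// (absM KT).
by rewrite ler_wpM2l ?(abs_ge0 KT).
Qed.

Definition absmx_bounded N : Prop :=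
  exists2 C, 0 < C & forall A, N A -> absmx absK A <= C.

(** The rates whose infimum turns out to be the joint spectral radius; they
    spare any further reference to products and limits. *)
Definition growth_bound N (l : R) : Prop :=
  0 <= l /\ exists2 w : 'cV[K]_d -> R, is_norm absK w &
    forall A, N A -> forall x, w (A *m x) <= l * w x.

Lemma growth_bound_le N l l' : l <= l' -> growth_bound N l -> growth_bound N l'.
Proof.
move=> ll' [l0 [w hw hA]]; split; first exact: le_trans ll'.
exists w => // A NA x; apply: le_trans (hA A NA x) _.
by rewrite ler_wpM2r// (seminorm_ge0 (norm_is_seminorm hw)).
Qed.

Lemma growth_bound_exists N : absmx_bounded N -> exists l, growth_bound N l.
Proof.
move=> [C C0 hC]; exists C; split; first exact: ltW.
exists (@absmx R K absK d 1) => [|A NA x]; first exact: absmx_norm KT _ _.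
apply: le_trans (absmx_mul _ _) _.
by rewrite ler_wpM2r ?(absmx_ge0 KT) ?hC.
Qed.

(** ** Products *)

Lemma productsP N k S : N !=set0 -> products N k S <->
  exists2 B : nat -> 'M[K]_d, (forall j, N (B j)) & S = \prod_(i < k) B i.
Proof.
move=> [A0 NA0]; split=> [[A hA ->]|[B hB ->]].
  exists (fun j => if insub j is Some i then A (rev_ord i) else A0) => [j|].
    by case: insub.
  by apply: eq_bigr => i _; rewrite valK.
exists (fun i => B (rev_ord i)) => [j|]; first exact: hB.
by apply: eq_bigr => i _; rewrite rev_ordK.
Qed.

Lemma products_neq0 N k : N !=set0 -> products N k !=set0.
Proof. by move=> [A NA]; exists (\prod_(i < k) A), (fun _ => A). Qed.

Lemma products_mulr N k S A : N !=set0 -> products N k S -> N A ->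
  products N k.+1 (S *m A).
Proof.
move=> N0 /(productsP _ _ N0)[B hB ->] NA; apply/(productsP _ _ N0).
exists (fun j => if (j < k)%N then B j else A) => [j|]; first by case: ifP.
rewrite big_ord_recr /= ltnn; congr (_ *m _).
by apply: eq_bigr => i _; rewrite ltn_ord.
Qed.

Lemma products_growth N l (w : 'cV[K]_d -> R) k S x : N !=set0 -> 0 <= l ->
  (forall A, N A -> forall x, w (A *m x) <= l * w x) ->
  products N k S -> w (S *m x) <= l ^+ k * w x.
Proof.
move=> N0 l0 hw /(productsP _ _ N0)[B hB ->] {S}.
elim: k x => [|k IHk] x; first by rewrite big_ord0 expr0 mul1r mul1mx.
rewrite big_ord_recr /= -mulmxA exprSr -mulrA.
by apply: le_trans (IHk _) _; rewrite ler_wpM2l ?exprn_ge0 ?hw.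
Qed.

(** ** Operator norms *)

Section Norm.
Context (nu : 'cV[K]_d -> R) (hnu : is_norm absK nu).
Let snu : is_seminorm absK nu := norm_is_seminorm hnu.

Lemma operator_norm_le A c : 0 <= c -> (forall x, nu (A *m x) <= c * nu x) ->
  operator_norm nu A <= c.
Proof.
move=> c0 h; apply: ge_sup; first by exists (nu (A *m 0)), 0 => //=;
  rewrite (seminorm0 KT snu).
move=> _ [x x1 <-]; apply: le_trans (h x) _.
by rewrite -[leRHS]mulr1 ler_wpM2l.
Qed.

Lemma mulmx_seminorm (p : 'cV[K]_d -> R) A : is_seminorm absK p ->
  is_seminorm absK (fun x => p (A *m x)).
Proof. exact: (@seminorm_comp _ _ _ _ _ (mulmx A)). Qed.

(** The supremum is finite because nu composed with A is a seminorm and nu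
    dominates the reference norm. *)
Lemma le_operator_norm A x : nu (A *m x) <= operator_norm nu A * nu x.
Proof.
have [C C0 hC] := seminorm_bounded KT (mulmx_seminorm A snu).
have [D D0 hD] := norm_lower_bound KT hnu.
have ub : has_ubound [set nu (A *m x) | x in [set x | nu x <= 1]].
  exists (C * D) => _ [y y1 <-]; apply: le_trans (hC y) _.
  rewrite ler_wpM2l ?(ltW C0)//; apply: le_trans (hD y) _.
  by rewrite ler_piMr ?(ltW D0).
have [x0|x0] := eqVneq (nu x) 0.
  have -> : x = 0 by case: hnu => _ h _ _; exact: h.
  by rewrite mulmx0 !(seminorm0 KT snu) mulr0.
have {}x0 : 0 < nu x by rewrite lt_neqAle eq_sym x0 (seminorm_ge0 snu).
have nx : absK (iota (nu x)^-1) = (nu x)^-1.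
  by rewrite (abs_iota KT) ger0_norm ?invr_ge0 ?(seminorm_ge0 snu).
rewrite -ler_pdivrMr// mulrC -nx -(seminormZ snu) scalemxAr.
apply: ub_le_sup => //; exists (iota (nu x)^-1 *: x) => //=.
by rewrite (seminormZ snu) nx mulVf ?gt_eqF.
Qed.

Lemma operator_norm_ge0 A : 0 <= operator_norm nu A.
Proof.
apply: sup_nonneg => _ [x _ <-]; exact: (seminorm_ge0 snu).
Qed.

Let maxnorm N k : R := sup [set operator_norm nu S | S in products N k].

Lemma maxnorm_ge0 N k : 0 <= maxnorm N k.
Proof. by apply: sup_nonneg => _ [S _ <-]; exact: operator_norm_ge0. Qed.

Lemma growth_bound_products N l : N !=set0 -> growth_bound N l ->
  exists2 C, 0 < C & forall k S x, products N k S ->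
    nu (S *m x) <= C * l ^+ k * nu x.
Proof.
move=> N0 [l0 [w hw hA]].
have [C C0 hC] := seminorm_bounded KT snu.
have [D D0 hD] := norm_lower_bound KT hw.
have [C' C'0 hC'] := seminorm_bounded KT (norm_is_seminorm hw).
have [D' D'0 hD'] := norm_lower_bound KT hnu.
exists (C * D * (C' * D')) => [|k S x hS]; first by rewrite !mulr_gt0.
have h1 : nu (S *m x) <= C * D * w (S *m x).
  apply: le_trans (hC _) _; rewrite -mulrA.
  by rewrite ler_wpM2l ?(ltW C0)// hD.
have h2 : w x <= C' * D' * nu x.
  apply: le_trans (hC' _) _; rewrite -mulrA.
  by rewrite ler_wpM2l ?(ltW C'0)// hD'.
apply: le_trans h1 _; rewrite -!mulrA.
rewrite ler_wpM2l ?(ltW C0)// ler_wpM2l ?(ltW D0)//.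
apply: le_trans (products_growth _ N0 l0 hA hS) _.
apply: le_trans (ler_wpM2l (exprn_ge0 k l0) h2) _.
by rewrite -mulrA mulrCA (mulrCA _ D').
Qed.

Lemma growth_bound_maxnorm N l : N !=set0 -> growth_bound N l ->
  exists2 C, 0 < C & forall k, maxnorm N k <= C * l ^+ k.
Proof.
move=> N0 hl; have [C C0 hC] := growth_bound_products N0 hl.
exists C => // k; apply: ge_sup.
  by have [S hS] := products_neq0 k N0; exists (operator_norm nu S), S.
move=> _ [S hS <-]; apply: operator_norm_le => [|x]; last exact: hC.
by rewrite mulr_ge0 ?exprn_ge0 ?(ltW C0)//; case: hl.
Qed.

(** Scaling the norms of the trajectories by mu^-j and adding them up for
    j <= k gives a norm that every matrix increases by a factor at most mu: the sum
    is shifted by one, and the new last term is controlled by the first one. *)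
Lemma growth_bound_of_maxnorm N mu k : N !=set0 -> absmx_bounded N -> 0 < mu ->
  maxnorm N k.+1 <= mu ^+ k.+1 -> growth_bound N mu.
Proof.
move=> N0 Nb mu0 hk; split; first exact: ltW.
have [l hl] := growth_bound_exists Nb.
have [C C0 hC] := growth_bound_products N0 hl.
pose s j x := sup [set nu (S *m x) | S in products N j].
have ub j x : has_ubound [set nu (S *m x) | S in products N j].
  by exists (C * l ^+ j * nu x) => _ [S hS <-]; exact: hC.
have ss j : is_seminorm absK (s j).
  apply: (seminorm_sup KT (products_neq0 j N0)) => // S _.
  exact: mulmx_seminorm.
have s0 x : s 0%N x = nu x.
  have p0 S : products N 0 S -> S *m x = x.
    by move=> [A _ ->]; rewrite big_ord0 mul1mx.
  rewrite /s; have [S hS] := products_neq0 0 N0.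
  have -> : [set nu (S *m x) | S in products N 0] = [set nu x].
    apply/seteqP; split=> [_ [T hT <-]|_ ->] /=; first by rewrite p0.
    by exists S => //; rewrite p0.
  exact: sup1.
have sS j A x : N A -> s j (A *m x) <= s j.+1 x.
  move=> NA; apply: ge_sup.
    by have [S hS] := products_neq0 j N0; exists (nu (S *m (A *m x))), S.
  move=> _ [S hS <-]; apply: ub_le_sup => //; exists (S *m A).
    exact: products_mulr.
  by rewrite mulmxA.
have sk x : s k.+1 x <= mu ^+ k.+1 * nu x.
  apply: ge_sup.
    by have [S hS] := products_neq0 k.+1 N0; exists (nu (S *m x)), S.
  move=> _ [S hS <-]; apply: le_trans (le_operator_norm _ _) _.
  rewrite ler_wpM2r ?(seminorm_ge0 snu)//; apply: le_trans hk.
  apply: ub_le_sup; last by exists S.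
  have [D D0 hD] := growth_bound_maxnorm N0 hl.
  exists (C * l ^+ k.+1) => _ [T hT <-].
  apply: operator_norm_le => [|y]; last exact: hC.
  by rewrite mulr_ge0 ?exprn_ge0 ?(ltW C0)//; case: hl.
pose w x := \sum_(j < k.+1) mu ^- j * s j x.
have sw : is_seminorm absK w.
  rewrite /w; elim: (k.+1) => [|n IHn].
    rewrite (_ : (fun x => _) = (fun _ => 0)); first exact: seminorm_zero.
    by apply/funext => x; rewrite big_ord0.
  rewrite (_ : (fun x => _) =
      (fun x => \sum_(j < n) mu ^- j * s j x + mu ^- n * s n x)).
    apply: seminorm_add => //; apply: seminorm_scale => //.
    by rewrite invr_ge0 exprn_ge0// ltW.
  by apply/funext => x; rewrite big_ord_recr.
have rest0 n x : 0 <= \sum_(j < n) mu ^- (lift ord0 j) * s (lift ord0 j) x.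
  apply: sumr_ge0 => j _; rewrite mulr_ge0 ?(seminorm_ge0 (ss _))//.
  by rewrite invr_ge0 exprn_ge0// ltW.
exists w => [|A NA x].
  case: (sw) => w1 w2 w3; split=> // x.
  rewrite /w big_ord_recl /= expr0 invr1 mul1r s0 => wx.
  have : nu x <= 0 by have := rest0 k x; rewrite /=; lra.
  rewrite le_eqVlt ltNge (seminorm_ge0 snu) orbF => /eqP.
  by case: hnu => _ h _ _; exact: h.
have -> : mu * w x = mu * (nu x - mu ^- k.+1 * s k.+1 x) +
    \sum_(j < k.+1) mu ^- j * s j.+1 x.
  (* The sum over 0 <= j <= k+1, split off at either end. *)
  have tel : w x + mu ^- k.+1 * s k.+1 x =
      nu x + \sum_(j < k.+1) mu ^- j.+1 * s j.+1 x.
    transitivity (\sum_(j < k.+2) mu ^- j * s j x).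
      by rewrite [RHS]big_ord_recr.
    by rewrite big_ord_recl /= expr0 invr1 mul1r s0.
  rewrite (canRL (addrK _) tel).
  rewrite addrAC mulrDr; congr (_ + _); rewrite mulr_sumr.
  apply: eq_bigr => j _; rewrite mulrA exprS invfM mulrA mulfV ?mul1r//.
  by rewrite gt_eqF.
apply: ler_wpDl.
  rewrite mulr_ge0 ?(ltW mu0)// subr_ge0 mulrC ler_pdivrMr ?exprn_gt0//.
  by rewrite mulrC.
apply: ler_sum => j _; rewrite ler_wpM2l ?sS//.
by rewrite invr_ge0 exprn_ge0// ltW.
Qed.

(** ** The limit *)

Section Limit.
Context (N : set 'M[K]_d) (N0 : N !=set0) (Nb : absmx_bounded N).

Let has_inf_growth : has_inf (growth_bound N).
Proof.
by split; [have [l] := growth_bound_exists Nb; exists l | exists 0 => l []].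
Qed.

Let root_cvg1 (c : R) : 0 < c ->
  c `^ (k%:R^-1) @[k --> \oo] --> (1 : R).
Proof.
move=> c0; rewrite (_ : (fun k => _) = expR \o (fun k => k%:R^-1 * ln c)).
  have inv0 : (k%:R : R)^-1 @[k --> \oo] --> (0 : R).
    apply/gtr0_cvgV0; last exact: cvgr_idn.
    by exists 1%N => // k /= k0; rewrite ltr0n.
  have ln0 : (k%:R : R)^-1 * ln c @[k --> \oo] --> 0 * ln c by exact: cvgMl.
  rewrite mul0r in ln0; have := continuous_cvg _ (@continuous_expR R 0) ln0.
  by rewrite expR0; exact.
by apply/funext => k /=; rewrite /powR gt_eqF.
Qed.

(** A rate l bounds the k-th term of the sequence by C^(1/k) l, and
    conversely every number above a term of the sequence is a rate.  This
    squeezes the sequence towards the infimum of the rates; in particular the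
    limit exists. *)
Lemma jsrE : joint_spectral_radius nu N = inf (growth_bound N).
Proof.
set rho := inf _.
apply: cvg_lim => //; apply/cvgrPdist_lt => e e0.
have e20 : 0 < e / 2 by rewrite divr_gt0.
have [l hl lr] := inf_adherent e20 has_inf_growth.
have [C C0 hC] := growth_bound_maxnorm N0 hl.
have l0 : 0 <= l by case: hl.
have cvl : C `^ (k%:R^-1) * l @[k --> \oo] --> 1 * l.
  by apply: cvgMl; exact: root_cvg1.
have /cvgrPdist_lt/(_ _ e20) near_l := cvl.
near=> k.
have k0 : (0 < k)%N by near: k; exact: nbhs_infty_gt.
have kR : k%:R != 0 :> R by rewrite pnatr_eq0 -lt0n.
have rootK (y : R) : 0 <= y -> (y ^+ k) `^ (k%:R^-1) = y.
  by move=> y0; rewrite -powR_mulrn// -powRrM mulfV// powRr1.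
have up : maxnorm N k `^ (k%:R^-1) <= C `^ (k%:R^-1) * l.
  rewrite -[X in _ * X](rootK l l0) -powRM ?(ltW C0) ?exprn_ge0//.
  apply: ge0_ler_powR => //; rewrite ?invr_ge0 ?nnegrE ?maxnorm_ge0//.
  by rewrite mulr_ge0 ?(ltW C0) ?exprn_ge0.
have lo : rho <= maxnorm N k `^ (k%:R^-1).
  apply/ler_addgt0Pr => h h0.
  apply: ge_inf; first exact: (proj2 has_inf_growth).
  set mu := _ + h.
  have mu0 : 0 < mu by rewrite ltr_wpDl ?powR_ge0.
  apply: (@growth_bound_of_maxnorm N mu k.-1) => //; rewrite prednK//.
  apply: le_trans (_ : (maxnorm N k `^ k%:R^-1) ^+ k <= _).
    by rewrite -powR_mulrn ?powR_ge0// -powRrM mulVf// powRr1 ?maxnorm_ge0.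
  by rewrite lerXn2r ?nnegrE ?powR_ge0 ?(ltW mu0)// lerDl ltW.
have cl : `|1 * l - C `^ (k%:R^-1) * l| < e / 2 by near: k.
rewrite -/(maxnorm N k).
move: up lo cl; rewrite mul1r; move: lr; rewrite -/rho.
move: (_ `^ _) (_ * l) => a b; rewrite ltr_norml ltr_norml => *.
by apply/andP; split; lra.
Unshelve. all: by end_near. Qed.

Lemma jsr_le l : growth_bound N l -> joint_spectral_radius nu N <= l.
Proof.
by move=> hl; rewrite jsrE; apply: ge_inf => //; exact: (proj2 has_inf_growth).
Qed.

Lemma jsr_lt l : joint_spectral_radius nu N < l -> growth_bound N l.
Proof.
rewrite jsrE => /(inf_lt (proj1 has_inf_growth))[l' hl' /ltW].
by move/growth_bound_le; apply.
Qed.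

Lemma jsr_ge0 : 0 <= joint_spectral_radius nu N.
Proof.
by rewrite jsrE; apply: lb_le_inf => [|l []//]; exact: (proj1 has_inf_growth).
Qed.

End Limit.
End Norm.
End Jsr.

(** * Invariant subspaces and eccentricity *)

(** A subspace of maximal dimension among those contained in P is all of P. *)
Lemma vspace_of_pred (F : fieldType) (E : vectType F) (P : E -> Prop) :
  P 0 -> (forall a x y, P x -> P y -> P (a *: x + y)) ->
  exists T : {vspace E}, forall x, x \in T <-> P x.
Proof.
move=> P0 Plin.
pose good n :=
  `[< exists2 T : {vspace E}, \dim T = n & forall x, x \in T -> P x >].
have ex : exists n, good n.
  exists 0%N; apply/asboolP; exists 0%VS; first exact: dimv0.
  by move=> x; rewrite memv0 => /eqP ->.
have ub n : good n -> (n <= \dim {:E})%N.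
  by move=> /asboolP[T <- _]; exact: dimvS (subvf T).
case: (ex_maxnP ex ub) => n /asboolP[T dT hT] nmax.
exists T => x; split; first exact: hT.
move=> Px; apply/negPn/negP => xT.
have : good (\dim (T + <[x]>)%VS).
  apply/asboolP; exists (T + <[x]>)%VS => //.
  move=> _ /memv_addP[u uT [_ /vlineP[a ->] ->]].
  by rewrite addrC; apply: Plin => //; exact: hT.
move=> /nmax; rewrite -dT; apply/negP; rewrite -ltnNge.
rewrite ltn_neqAle dimvS ?addvSl// andbT; apply: contra xT => /eqP dTx.
have /eqP -> : T == (T + <[x]>)%VS by rewrite eqEdim addvSl -dTx leqnn.
by apply: (subvP (addvSr T <[x]>)); exact: memv_line.
Qed.

Section Invariant.
Context (R : realType) (K : numFieldType) (iota : R -> K) (absK : K -> R).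
Context (KT : scalar_theory iota absK).
Context (d : nat).
Implicit Types (A : 'M[K]_d) (x y : 'cV[K]_d) (U W : {vspace 'cV[K]_d}).

Let mag (x : 'cV[K]_d) : R := absmx absK x.
Let mag_seminorm : is_seminorm absK mag := absmx_seminorm KT d 1.

Definition no_intermediate (M : set 'M[K]_d) U W : Prop :=
  forall T, invariant_subspace M T -> (U <= T)%VS -> (T <= W)%VS ->
    T = U \/ T = W.

Section Eccentricity.
Context (M : set 'M[K]_d) (U W : {vspace 'cV[K]_d}) (L : R).
Context (invW : invariant_subspace M W) (UW : (U <= W)%VS).
Context (irr : no_intermediate M U W) (L0 : 0 <= L).

(** Seminorms of the quotient W / U, pulled back to W so that the quotient
    space need not be formed. *)
Definition admissible (q : 'cV[K]_d -> R) : Prop :=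
  [/\ is_seminorm absK q, forall u, u \in U -> q u = 0
    & forall A, M A -> forall x, x \in W -> q (A *m x) <= L * q x].

(** The vectors y that are controlled by x0, uniformly in q, form an invariant
    subspace between U and W.  It contains x0, so it cannot be U. *)
Lemma admissible_controlled x0 : x0 \in W -> x0 \notin U ->
  forall y, y \in W ->
    exists2 c, 0 <= c & forall q, admissible q -> q y <= c * q x0.
Proof.
move=> x0W x0U.
pose P y := y \in W /\
  exists2 c, 0 <= c & forall q, admissible q -> q y <= c * q x0.
have PU y : y \in U -> P y.
  move=> yU; split; first exact: (subvP UW).
  by exists 0 => // q [_ qU _]; rewrite qU// mul0r.
have [T hT] : exists T : {vspace 'cV[K]_d}, forall x, x \in T <-> P x.
  apply: vspace_of_pred => [|a x y [xW [c c0 hc]] [yW [c' c'0 hc']]].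
    by apply: PU; exact: mem0v.
  split; first by rewrite memvD// memvZ.
  exists (absK a * c + c') => [|q hq].
    by rewrite addr_ge0// mulr_ge0 ?(abs_ge0 KT).
  have [sq _ _] := hq; apply: le_trans (seminormD sq _ _) _.
  rewrite mulrDl -mulrA lerD ?hc'// (seminormZ sq).
  by rewrite ler_wpM2l ?(abs_ge0 KT) ?hc.
have invT : invariant_subspace M T.
  move=> A MA x /hT[xW [c c0 hc]]; apply/hT; split; first exact: invW.
  exists (L * c) => [|q hq]; first exact: mulr_ge0.
  have [_ _ qA] := hq; apply: le_trans (qA A MA x xW) _.
  by rewrite -mulrA ler_wpM2l ?hc.
have TW : (T <= W)%VS by apply/subvP => x /hT[].
have UT : (U <= T)%VS by apply/subvP => x /PU/hT.
have [TU|TW'] := irr invT UT TW; last first.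
  by move=> y; rewrite -{1}TW' => /hT[].
case/negP: x0U; rewrite -TU; apply/hT; split=> //.
by exists 1 => // q _; rewrite mul1r.
Qed.

(** The supremum of the normalized seminorms q / q(x0) is finite by
    admissible_controlled, hence a seminorm, hence bounded. *)
Lemma admissible_controlled_uniform x0 : x0 \in W -> x0 \notin U ->
  exists2 C, 0 < C &
    forall q, admissible q -> forall y, y \in W -> q y <= C * mag y * q x0.
Proof.
move=> x0W x0U; have ctl := admissible_controlled x0W x0U.
(* If q x0 = 0 then p q = 0, in accordance with q vanishing on W.  The
   projection onto W makes the supremum finite everywhere. *)
pose p (q : 'cV[K]_d -> R) x := (q x0)^-1 * q (projv W x).
have sp q : admissible q -> is_seminorm absK (p q).
  move=> [sq _ _]; apply: seminorm_scale.
    by rewrite invr_ge0 (seminorm_ge0 sq).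
  exact: (seminorm_comp (projv W) sq).
have D0 : admissible !=set0.
  exists (fun=> 0); split=> //; first exact: seminorm_zero.
  by move=> A _ x _; rewrite mulr0.
have ub x : has_ubound [set p q x | q in admissible].
  have [c c0 hc] := ctl _ (memv_proj W x).
  exists c => _ [q hq <-]; have [sq _ _] := hq; rewrite /p.
  have [q0|q0] := eqVneq (q x0) 0; first by rewrite q0 invr0 mul0r.
  rewrite mulrC ler_pdivrMr ?hc//.
  by rewrite lt_neqAle eq_sym q0 (seminorm_ge0 sq).
have [C C0 hC] := seminorm_bounded KT (seminorm_sup KT D0 sp ub).
exists C => // q hq y yW; have [sq _ _] := hq.
have [q0|q0] := eqVneq (q x0) 0.
  by have [c _ /(_ _ hq)] := ctl _ yW; rewrite q0 !mulr0.
have {}q0 : 0 < q x0 by rewrite lt_neqAle eq_sym q0 (seminorm_ge0 sq).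
rewrite -ler_pdivrMr// mulrC; apply: le_trans (hC y).
apply: (@ub_le_sup _ [set p q y | q in admissible]) => //; exists q => //.
by rewrite /p projv_id.
Qed.

(** The bound at a point x0 persists nearby: for x in W the difference x - x0 is
    itself controlled by x0, so q(x0) <= 2 q(x) when x is close to x0.
    Compactness of the sphere then gives one constant for all x; the projection
    condition confines x to a complement of U, whose nonzero vectors all lie
    outside U. *)
Lemma eccentricity_bound : exists2 C, 0 < C &
  forall q, admissible q -> forall x y, x \in W -> projv U x = 0 -> y \in W ->
    q y * mag x <= C * mag y * q x.
Proof.
pose Q c x := x \in W -> projv U x = 0 ->
  forall q, admissible q -> forall y, y \in W -> q y <= c * mag y * q x.
have [||c hc] := sphere_uniform KT (Q := Q).
- move=> c c' x cc' h xW xU q hq y yW; apply: le_trans (h xW xU q hq y yW) _.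
  have [sq _ _] := hq.
  by rewrite ler_wpM2r ?(seminorm_ge0 sq)// ler_wpM2r// (absmx_ge0 KT).
- move=> x0 x00; have [[x0W x0U]|x0UW] := pselect (x0 \in W /\ projv U x0 = 0).
    have x0U' : x0 \notin U.
      by apply: contra x00 => /projv_id; rewrite x0U => <-.
    have [C C0 hC] := admissible_controlled_uniform x0W x0U'.
    exists (2 * C)^-1; first by rewrite invr_gt0 mulr_gt0.
    exists (C * 2) => x hx xW xU q hq y yW; apply: le_trans (hC q hq y yW) _.
    have [sq _ _] := hq.
    rewrite (_ : C * 2 * mag y * q x = C * mag y * (2 * q x)); last by ring.
    rewrite ler_wpM2l ?mulr_ge0 ?(ltW C0) ?(absmx_ge0 KT)//.
    have := seminorm_le_distl sq x0 x.
    rewrite -(seminormN KT sq (x0 - x)) opprB.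
    have := hC q hq (x - x0) (memvB xW x0W); rewrite -/(mag _) in hx *.
    have h2 : C * mag (x - x0) <= 2^-1.
      by rewrite -ler_pdivlMl// -invfM mulrC ltW // mulrC.
    have := ler_wpM2r (seminorm_ge0 sq x0) h2; lra.
  (* The condition on x is closed: it says that g x = 0. *)
  pose g x := mag (x - projv W x) + mag (projv U x).
  have sg : is_seminorm absK g.
    apply: seminorm_add; last exact: (seminorm_comp (projv U) mag_seminorm).
    split=> [x|a x|x y]; first exact: seminorm_ge0 mag_seminorm _.
      by rewrite linearZ -scalerBr (seminormZ mag_seminorm).
    by rewrite linearD opprD addrACA (seminormD mag_seminorm).
  have g0 : 0 < g x0.
    rewrite lt_neqAle (seminorm_ge0 sg) andbT eq_sym; apply/negP => /eqP gx0.
    have h1 := absmx_ge0 KT (x0 - projv W x0).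
    have h2 := absmx_ge0 KT (projv U x0).
    apply: x0UW; split.
      have /eqP : mag (x0 - projv W x0) = 0 by move: gx0; rewrite /g /mag; lra.
      have [//|/(absmx_gt0 KT)/gt_eqF ->//] := eqVneq (x0 - projv W x0) 0.
      by move=> /eqP; rewrite subr_eq0 => /eqP -> _; exact: memv_proj.
    have /eqP : mag (projv U x0) = 0 by move: gx0; rewrite /g /mag; lra.
    by have [//|/(absmx_gt0 KT)/gt_eqF ->//] := eqVneq (projv U x0) 0.
  have [B B0 hB] := seminorm_bounded KT sg.
  exists (g x0 / B); first exact: divr_gt0.
  exists 0 => x hx xW xU; exfalso.
  have gx : g x = 0.
    by rewrite /g xU projv_id// subrr !(seminorm0 KT mag_seminorm) addr0.
  have := seminorm_le_distl sg x0 x; rewrite gx add0r.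
  rewrite -(seminormN KT sg (x0 - x)) opprB leNgt => /negP; apply.
  by apply: le_lt_trans (hB _) _; rewrite mulrC -ltr_pdivlMr.
exists (`|c| + 1) => [|q hq x y xW xU yW]; first by rewrite ltr_wpDl.
have [sq _ _] := hq.
have [->|x0] := eqVneq x 0.
  by rewrite (seminorm0 KT mag_seminorm) (seminorm0 KT sq) !mulr0.
have x0' : 0 < mag x by exact: (absmx_gt0 KT).
have := hc _ (absmx_normalize KT x0) _ _ q hq y yW.
rewrite memvZ// linearZ/= xU scaler0 => /(_ isT erefl).
rewrite (seminormZ sq) (abs_iota KT) ger0_norm ?invr_ge0 ?(absmx_ge0 KT)//.
rewrite -/(mag x) mulrCA mulrC ler_pdivlMr// => /le_trans; apply.
rewrite ler_wpM2r ?(seminorm_ge0 sq)// ler_wpM2r ?(absmx_ge0 KT)//.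
by rewrite (le_trans (ler_norm c))// lerDl.
Qed.

End Eccentricity.

(** ** Quotient seminorms *)

Section Quotient.
Context (w : 'cV[K]_d -> R) (hw : is_norm absK w) (U : {vspace 'cV[K]_d}).
Let sw : is_seminorm absK w := norm_is_seminorm hw.

Definition quotient_seminorm x : R := inf [set w (x - u) | u in [set` U]].

Let q := quotient_seminorm.

Let q_has_inf x : has_inf [set w (x - u) | u in [set` U]].
Proof.
split; first by exists (w (x - 0)), 0 => //=; exact: mem0v.
by exists 0 => _ [u _ <-]; exact: seminorm_ge0 sw _.
Qed.

Lemma quotient_le x u : u \in U -> q x <= w (x - u).
Proof. by move=> uU; apply: ge_inf; [have [] := q_has_inf x | exists u]. Qed.

Lemma quotient_ge x c : (forall u, u \in U -> c <= w (x - u)) -> c <= q x.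
Proof.
move=> h; apply: lb_le_inf; first by have [] := q_has_inf x.
by move=> _ [u uU <-]; exact: h.
Qed.

Lemma quotient_seminormP : is_seminorm absK q.
Proof.
apply: (seminorm_of_le KT) => [x|a x|x y].
- by apply: quotient_ge => u _; exact: seminorm_ge0 sw _.
- have [->|a0] := eqVneq a 0.
    rewrite (abs0 KT) mul0r scale0r.
    apply: le_trans (quotient_le _ (mem0v U)) _.
    by rewrite subr0 (seminorm0 KT sw).
  rewrite mulrC -ler_pdivrMr ?(abs_gt0 KT)//; apply: quotient_ge => u uU.
  rewrite ler_pdivrMr ?(abs_gt0 KT)// mulrC -(seminormZ sw) scalerBr.
  by apply: quotient_le; exact: memvZ.
- rewrite -lerBlDr; apply: quotient_ge => u uU; rewrite lerBlDr.
  rewrite [w _ + _]addrC -lerBlDr.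
  apply: quotient_ge => u' u'U; rewrite lerBlDr addrC.
  apply: le_trans (seminormD sw _ _); rewrite addrACA -opprD.
  by apply: quotient_le; exact: memvD.
Qed.

Lemma quotient_eq0 u : u \in U -> q u = 0.
Proof.
move=> uU; apply/eqP; rewrite eq_le (seminorm_ge0 quotient_seminormP) andbT.
by apply: le_trans (quotient_le _ uU) _; rewrite subrr (seminorm0 KT sw).
Qed.

(** Subspaces are closed: id - projv U is bounded, vanishes on U and does not
    vanish at x. *)
Lemma quotient_gt0 x : x \notin U -> 0 < q x.
Proof.
move=> xU; pose p y := y - projv U y.
have p0 : 0 < mag (p x).
  apply: (absmx_gt0 KT); apply: contra xU; rewrite subr_eq0 => /eqP ->.
  exact: memv_proj.
have sp : is_seminorm absK (mag \o p).
  split=> [y|a y|y z] /=; first exact: seminorm_ge0 mag_seminorm _.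
    by rewrite /p linearZ -scalerBr (seminormZ mag_seminorm).
  by rewrite /p linearD opprD addrACA (seminormD mag_seminorm).
have [B B0 hB] := seminorm_bounded KT sp.
have [D D0 hD] := norm_lower_bound KT hw.
apply: lt_le_trans (_ : mag (p x) / (B * D) <= _).
  by rewrite divr_gt0// mulr_gt0.
apply: quotient_ge => u uU; rewrite ler_pdivrMr ?mulr_gt0// mulrC.
have -> : mag (p x) = (mag \o p) (x - u).
  by rewrite /p /= linearB /= (projv_id uU) opprB subrKA.
apply: le_trans (hB _) _; rewrite -mulrA ler_wpM2l ?(ltW B0)//.
Qed.

Lemma quotient_contract A l : 0 <= l -> (forall x, w (A *m x) <= l * w x) ->
  (forall u, u \in U -> A *m u \in U) -> forall x, q (A *m x) <= l * q x.
Proof.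
move=> l0 hA invA x; have [l00|l00] := eqVneq l 0.
  rewrite l00 mul0r; apply: le_trans (quotient_le _ (mem0v U)) _.
  by rewrite subr0; apply: le_trans (hA x) _; rewrite l00 mul0r.
have {}l0 : 0 < l by rewrite lt_neqAle eq_sym l00.
rewrite mulrC -ler_pdivrMr//; apply: quotient_ge => u uU.
rewrite ler_pdivrMr// mulrC; apply: le_trans (hA _); rewrite mulmxBr.
by apply: quotient_le; exact: invA.
Qed.

End Quotient.
End Invariant.

(** * Norms adapted to an invariant flag *)

Section Flag.
Context (R : realType) (K : numFieldType) (iota : R -> K) (absK : K -> R).
Context (KT : scalar_theory iota absK).
Context (d : nat) (M : set 'M[K]_d) (Mb : absmx_bounded absK M).
Implicit Types (A B : 'M[K]_d) (x y : 'cV[K]_d).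

Let mag (x : 'cV[K]_d) : R := absmx absK x.
Let mag_seminorm : is_seminorm absK mag := absmx_seminorm KT d 1.

Definition contracts l (w : 'cV[K]_d -> R) : Prop :=
  forall A, M A -> forall x, w (A *m x) <= l * w x.

(** Climbing one step of the flag.  The new seminorm is that of the component
    in U, plus the normalized quotient seminorm of w with weight eta^-k.  The
    component that a matrix of M moves from the complement into U has size
    O(eta^(1-k)), that is O(eta) times the weight, so that the rate only
    grows by O(eta). *)
Lemma adapted_step (U W : {vspace 'cV[K]_d}) (L : R) (k : nat) (C : R) :
  invariant_subspace M U -> invariant_subspace M W ->
  (U <= W)%VS -> U != W -> no_intermediate M U W -> 0 <= L -> 0 < C ->
  exists2 C', 0 < C' & forall eta l w v,
    0 < eta -> eta <= 1 -> 0 <= l -> l <= L ->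
    is_norm absK w -> contracts l w ->
    is_seminorm absK v ->
    (forall A, M A -> forall x, x \in U ->
      v (A *m x) <= (l + C * eta) * v x) ->
    (forall x, x \in U -> mag x <= C * v x) ->
    (forall x, x \in U -> v x * eta ^+ k <= C * eta * mag x) ->
    exists2 v', is_seminorm absK v' &
    [/\ forall A, M A -> forall x, x \in W ->
          v' (A *m x) <= (l + C' * eta) * v' x,
        forall x, x \in W -> mag x <= C' * v' x
      & forall x, x \in W -> v' x * eta ^+ k.+1 <= C' * eta * mag x].
Proof.
move=> invU invW UW nUW irr L0 C0.
have [Ce Ce0 hCe] := eccentricity_bound KT invW UW irr L0.
have [kQ kQ0 hQ] := linear_bounded KT (projv U).
have [kA kA0 hA] := Mb.
(* The quotient seminorm is normalized to be 1 at this unit vector. *)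
have [x0 [x0W x0U x0P]] : exists x0, [/\ x0 \in W, x0 \notin U &
    projv U x0 = 0 /\ mag x0 = 1].
  have [z [zW zU]] : exists z, z \in W /\ z \notin U.
    apply: contrapT => h; move: nUW; rewrite eqEsubv UW /= => /negP; apply.
    apply/subvP => z zW; apply/negPn/negP => zU; by apply: h; exists z.
  have e0 : z - projv U z != 0.
    by apply: contra zU; rewrite subr_eq0 => /eqP ->; exact: memv_proj.
  have Pe : projv U (z - projv U z) = 0.
    by rewrite linearB /= (projv_id (memv_proj U z)) subrr.
  exists (iota (mag (z - projv U z))^-1 *: (z - projv U z)).
  have m1 := absmx_normalize KT e0; split.
  - by rewrite memvZ// memvB// (subvP UW)// memv_proj.
  - apply/negP => /projv_id; rewrite linearZ/= Pe scaler0 => h.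
    by move: m1; rewrite -/(mag _) -h (seminorm0 KT mag_seminorm) => /eqP;
      rewrite eq_sym oner_eq0.
  - by split; rewrite // linearZ/= Pe scaler0.
have [x0P' x01] := x0P.
pose C1 := C + C * kQ * kA * Ce + Ce + C * kQ.
have P1 : 0 <= C * kQ * kA * Ce by rewrite ltW// !mulr_gt0.
have P2 : 0 <= C * kQ by rewrite ltW// mulr_gt0.
have C1C : C <= C1 by rewrite /C1; lra.
have C1x : C * kQ * kA * Ce <= C1 by rewrite /C1; lra.
have C1e : Ce <= C1 by rewrite /C1; lra.
have C1b : C * kQ + Ce <= C1 by rewrite /C1; lra.
exists C1; first exact: lt_le_trans C1C.
move=> eta l w v eta0 eta1 l0 lL hw cw sv vA vlow vup.
pose q := quotient_seminorm w U; pose c := q x0.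
have sq : is_seminorm absK q := quotient_seminormP KT hw U.
have c0 : 0 < c by exact: (quotient_gt0 KT hw).
have qA A : M A -> forall x, q (A *m x) <= l * q x.
  move=> MA; apply: (quotient_contract hw l0) => [x|]; first exact: cw.
  exact: invU.
have adm : admissible absK M U W L q.
  split=> // [u|A MA x _]; first exact: (quotient_eq0 KT hw).
  by apply: le_trans (qA A MA x) _; rewrite ler_wpM2r ?(seminorm_ge0 sq).
pose p x := c^-1 * q x.
have sp : is_seminorm absK p.
  by apply: seminorm_scale => //; rewrite invr_ge0 ltW.
have pup y : y \in W -> p y <= Ce * mag y.
  move=> yW; rewrite /p mulrC ler_pdivrMr//.
  by have := hCe q adm x0 y x0W x0P' yW; rewrite -/(mag x0) x01 mulr1.
have plow x : x \in W -> projv U x = 0 -> mag x <= Ce * p x.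
  move=> xW xU; rewrite /p mulrCA mulrC ler_pdivlMr// mulrC.
  have := hCe q adm x x0 xW xU x0W.
  by rewrite -/(mag x0) x01 mulr1.
have pA A x : M A -> p (A *m x) <= l * p x.
  move=> MA; rewrite /p mulrCA ler_wpM2l ?invr_ge0 ?(ltW c0)//; exact: qA.
have pE x : p (x - projv U x) = p x.
  have pU y u : u \in U -> p (y + u) <= p y.
    move=> uU; apply: le_trans (seminormD sp _ _) _.
    by rewrite /p /q (quotient_eq0 KT hw uU) mulr0 addr0.
  apply/eqP; rewrite eq_le pU ?memvN ?memv_proj//=.
  by rewrite -{1}(subrK (projv U x) x) pU// memv_proj.
pose E x := x - projv U x.
have EW x : x \in W -> E x \in W.
  by move=> xW; rewrite memvB// (subvP UW)// memv_proj.
have EU x : projv U (E x) = 0.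
  by rewrite /E linearB /= (projv_id (memv_proj U x)) subrr.
have Elow x : x \in W -> mag (E x) <= Ce * p x.
  by move=> xW; rewrite -(pE x); apply: plow; [exact: EW | exact: EU].
have ek0 : 0 < eta ^- k by rewrite invr_gt0 exprn_gt0.
have ek1 : 1 <= eta ^- k.
  by rewrite invf_ge1 ?exprn_gt0// exprn_ile1// ltW.
pose v' x := v (projv U x) + eta ^- k * p x.
exists v'.
  apply: seminorm_add; first exact: (seminorm_comp (projv U) sv).
  by apply: seminorm_scale => //; exact: ltW.
have p0 x : 0 <= p x by exact: seminorm_ge0 sp x.
have v0 x : 0 <= v x by exact: seminorm_ge0 sv x.
split.
- move=> A MA x xW.
  rewrite /v'; have -> : projv U (A *m x) = A *m projv U x + projv U (A *m E x).
    rewrite -{1}(subrK (projv U x) x) addrC mulmxDr linearD /=; congr (_ + _).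
    by apply: projv_id; apply: invU => //; exact: memv_proj.
  have h1 : v (projv U (A *m E x)) <= C * kQ * kA * Ce * eta * (eta ^- k * p x).
    have := vup _ (memv_proj U (A *m E x)).
    rewrite -ler_pdivlMr ?exprn_gt0// => /le_trans; apply.
    rewrite [leRHS](_ : _ =
      C * eta * (kQ * (kA * (Ce * p x))) / eta ^+ k); last by ring.
    rewrite ler_wpM2r ?(ltW ek0)// ler_wpM2l ?mulr_ge0 ?(ltW C0) ?(ltW eta0)//.
    apply: le_trans (hQ _) _; rewrite ler_wpM2l ?(ltW kQ0)//.
    apply: le_trans (absmx_mul KT _ _) _.
    apply: ler_pM; rewrite ?(absmx_ge0 KT)//; [exact: hA | exact: Elow].
  have h2 := vA A MA _ (memv_proj U x).
  have h3 := pA A x MA.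
  have h4 : eta ^- k * p (A *m x) <= l * (eta ^- k * p x).
    by rewrite [leRHS]mulrCA ler_wpM2l ?(ltW ek0).
  apply: le_trans (_ : v (A *m projv U x) + v (projv U (A *m E x)) +
    eta ^- k * p (A *m x) <= _); first by rewrite lerD2r (seminormD sv).
  apply: le_trans (_ : (l + C * eta) * v (projv U x) +
     (l + C * kQ * kA * Ce * eta) * (eta ^- k * p x) <= _).
    by move: h1 h2 h4; lra.
  rewrite [leRHS]mulrDr lerD//.
    apply: ler_wpM2r; first exact: v0.
    by rewrite lerD2l ler_wpM2r ?(ltW eta0).
  apply: ler_wpM2r; first by rewrite mulr_ge0 ?p0// ltW.
  by rewrite lerD2l ler_wpM2r ?(ltW eta0).
- move=> x xW.
  have := vlow _ (memv_proj U x).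
  have := Elow x xW.
  have := seminormD mag_seminorm (E x) (projv U x); rewrite /E subrK.
  have h1 : Ce * p x <= C1 * (eta ^- k * p x).
    by apply: ler_pM; rewrite ?(ltW Ce0)// ler_peMl.
  have h2 : C * v (projv U x) <= C1 * v (projv U x) by rewrite ler_wpM2r.
  by move: h1 h2; rewrite /v' mulrDr; lra.
- move=> x xW.
  have h1 := vup _ (memv_proj U x).
  have h2 : mag (projv U x) <= kQ * mag x by exact: hQ.
  rewrite /v' mulrDl exprSr mulrA.
  have h3 : eta ^- k * p x * (eta ^+ k * eta) = p x * eta.
    rewrite [_ * p x]mulrC -mulrA; congr (_ * _).
    by rewrite mulKf// expf_neq0 ?gt_eqF.
  rewrite h3.
  have h4 : p x * eta <= Ce * mag x * eta by rewrite ler_wpM2r ?(ltW eta0) ?pup.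
  have h5 : v (projv U x) * eta ^+ k * eta <= C * (kQ * mag x) * eta.
    rewrite ler_wpM2r ?(ltW eta0)//; apply: le_trans h1 _.
    rewrite -[C * eta]mulr1 -mulrA -mulrA ler_wpM2l ?(ltW C0)//.
    rewrite mul1r; apply: le_trans h2; rewrite ler_piMl// (absmx_ge0 KT)//.
  apply: le_trans (lerD h5 h4) _.
  rewrite [leLHS](_ : _ = (C * kQ + Ce) * eta * mag x); last by ring.
  by rewrite ler_wpM2r ?(absmx_ge0 KT)// ler_wpM2r ?(ltW eta0).
Qed.

(** Induction along the flag.  The seminorm on F i is kept below
    C eta^(1-i) |x|, which is written without negative exponents; for i = 0 the
    zero seminorm will do. *)
Lemma adapted_norm m (F : nat -> {vspace 'cV[K]_d}) (L : R) :
  invariant_flag M m F ->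
  (forall i, (i < m)%N -> no_intermediate M (F i) (F i.+1)) -> 0 <= L ->
  exists2 C, 0 < C & forall eta l,
    0 < eta -> eta <= 1 -> l <= L -> growth_bound absK M l ->
    exists2 v, is_norm absK v &
      contracts (l + C * eta) v /\
      forall B x, v (B *m x) * eta ^+ m <= C * eta * absmx absK B * v x.
Proof.
move=> [F0 Fm Fstrict Finv] irr L0.
have main i : (i <= m)%N -> exists2 C, 0 < C & forall eta l w,
    0 < eta -> eta <= 1 -> 0 <= l -> l <= L ->
    is_norm absK w -> contracts l w ->
    exists2 v, is_seminorm absK v &
    [/\ forall A, M A -> forall x, x \in F i ->
          v (A *m x) <= (l + C * eta) * v x,
        forall x, x \in F i -> mag x <= C * v x
      & forall x, x \in F i -> v x * eta ^+ i <= C * eta * mag x].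
  elim: i => [|i IHi] im.
    exists 1 => // eta l w eta0 eta1 l0 lL hw cw.
    exists (fun=> 0); first exact: seminorm_zero.
    split=> [A _ x _|x|x _]; first by rewrite mulr0.
      by rewrite F0 memv0 => /eqP ->; rewrite (seminorm0 KT mag_seminorm) mulr0.
    by rewrite mul0r mulr_ge0 ?(absmx_ge0 KT)// mul1r ltW.
  have [C C0 hC] := IHi (ltnW im).
  have [sF nF] := Fstrict i im.
  have [C' C'0 hC'] := adapted_step i (Finv i (ltnW im)) (Finv i.+1 im) sF nF
    (irr i im) L0 C0.
  exists C' => // eta l w eta0 eta1 l0 lL hw cw.
  have [v sv [v1 v2 v3]] := hC eta l w eta0 eta1 l0 lL hw cw.
  exact: hC' eta l w v eta0 eta1 l0 lL hw cw sv v1 v2 v3.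
have [C C0 hC] := main m (leqnn m).
exists (C + C * C) => [|eta l eta0 eta1 lL [l0 [w hw cw]]].
  by rewrite addr_gt0 ?mulr_gt0.
have [v sv [v1 v2 v3]] := hC eta l w eta0 eta1 l0 lL hw cw.
have full x : x \in F m by rewrite Fm memvf.
have v0 x : 0 <= v x by exact: seminorm_ge0 sv x.
exists v; last split.
- case: (sv) => a b c; split=> // x vx0.
  apply/eqP/negPn/negP => /(absmx_gt0 KT).
  by rewrite ltNge; apply/negP/negPn; have := v2 x (full x); rewrite vx0 mulr0.
- move=> A MA x; apply: le_trans (v1 A MA x (full x)) _.
  rewrite ler_wpM2r// lerD2l ler_wpM2r ?(ltW eta0)// lerDl.
  by rewrite mulr_ge0 ?ltW.
- move=> B x; apply: le_trans (v3 _ (full _)) _.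
  apply: le_trans (_ : C * eta * (absmx absK B * (C * v x)) <= _).
    rewrite ler_wpM2l ?mulr_ge0 ?(ltW C0) ?(ltW eta0)//.
    apply: le_trans (absmx_mul KT _ _) _.
    by rewrite ler_wpM2l ?(absmx_ge0 KT) ?v2.
  rewrite [leLHS](_ : _ = C * C * eta * absmx absK B * v x); last by ring.
  rewrite ler_wpM2r// ler_wpM2r ?(absmx_ge0 KT)// ler_wpM2r ?(ltW eta0)//.
  by rewrite lerDr ltW.
Qed.

(** The eccentricity bound for U = 0, where the admissible seminorms are those
    of the whole space: the constant depends on the rate of w only through
    L. *)
Lemma irreducible_norm (L : R) : no_intermediate M 0%VS fullv -> 0 <= L ->
  exists2 C, 0 < C & forall l w, l <= L -> is_norm absK w -> contracts l w ->
    forall B x, w (B *m x) <= C * absmx absK B * w x.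
Proof.
move=> irr L0.
have invT : invariant_subspace M fullv by move=> A _ x _; exact: memvf.
have [C C0 hC] := eccentricity_bound KT invT (subvf _) irr L0.
exists C => // l w lL hw cw B x; have sw := norm_is_seminorm hw.
have [->|x0] := eqVneq x 0.
  by rewrite mulmx0 (seminorm0 KT sw) mulr0.
have adm : admissible absK M 0%VS fullv L w.
  split=> // [u|A MA y _].
    by rewrite memv0 => /eqP ->; exact: (seminorm0 KT sw).
  by apply: le_trans (cw A MA y) _; rewrite ler_wpM2r ?(seminorm_ge0 sw).
have proj0 : projv 0%VS x = 0.
  by apply/eqP; rewrite -memv0; exact: memv_proj.
rewrite -(ler_pM2r (absmx_gt0 KT x0)).
apply: le_trans (hC w adm x (B *m x) (memvf _) proj0 (memvf _)) _.
rewrite [leRHS](_ : _ = C * (absmx absK B * absmx absK x) * w x); last by ring.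
rewrite ler_wpM2r ?(seminorm_ge0 sw)// ler_wpM2l ?(ltW C0)//.
exact: (absmx_mul KT).
Qed.

End Flag.

(** An intermediate subspace could be inserted into the flag. *)
Lemma maximal_flag_no_intermediate (K : numFieldType) d
    (M : set 'M[K]_d) m (F : nat -> {vspace 'cV[K]_d}) :
  maximal_invariant_flag M m F ->
  forall i, (i < m)%N -> no_intermediate M (F i) (F i.+1).
Proof.
move=> [[F0 Fm Fstrict Finv] Fmax] i im T invT FT TF.
apply: contrapT => /not_orP[nTF nTF'].
pose G j := if (j <= i)%N then F j else if j == i.+1 then T else F j.-1.
have Gle j : (j <= i)%N -> G j = F j by rewrite /G => ->.
have GT : G i.+1 = T by rewrite /G ltnn eqxx.
have Ggt j : (i < j)%N -> G j.+1 = F j.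
  move=> ij; rewrite /G ifN -?ltnNge ?ltnS 1?ltnW// ifN//.
  by rewrite eqSS gtn_eqF.
suff /Fmax/(_ _) h : invariant_flag M m.+1 G.
  suff : m.+1 = m by move=> /eqP; rewrite eqn_leq ltnn.
  apply: h => j jm; have [ji|ij] := leqP j i.
    by exists j; [exact: leqW | exact: Gle].
  by exists j.+1 => //; exact: Ggt.
split.
- by rewrite Gle.
- by rewrite Ggt.
- move=> j jm; have [ji|ij|->] := ltngtP j i.
  + by rewrite !Gle// 1?ltnW//; apply: Fstrict; exact: ltn_trans im.
  + move: ij; rewrite leq_eqVlt => /predU1P[<-|ij].
      by rewrite GT Ggt//; split=> //; apply/eqP.
    case: j jm ij => // j jm ij; rewrite !Ggt ?ltnS//.
      by apply: Fstrict.
    exact: ltnW.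
  + by rewrite Gle// GT; split=> //; apply/eqP => h; apply: nTF.
- move=> j jm; have [ji|ij] := leqP j i.
    by rewrite Gle//; apply: Finv; apply: leq_trans ji _; exact: ltnW.
  move: ij; rewrite leq_eqVlt => /predU1P[<-|ij]; first by rewrite GT.
  by case: j jm ij => // j jm ij; rewrite Ggt//; exact: Finv.
Qed.

(** * Perturbations *)

Section Perturbation.
Context (R : realType) (K : numFieldType) (iota : R -> K) (absK : K -> R).
Context (KT : scalar_theory iota absK).
Context (d : nat) (nu : 'cV[K]_d -> R) (hnu : is_norm absK nu).
Context (M : set 'M[K]_d) (M0 : M !=set0) (Mb : absmx_bounded absK M).
Context (V : {vspace 'M[K]_d}) (N : 'M[K]_d -> R) (hN : is_norm absK N).
Implicit Types (A B : 'M[K]_d) (x : 'cV[K]_d) (e l : R).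

Let P e := perturbed iota M V N e.
Let r e := joint_spectral_radius nu (P e).
Let sN : is_seminorm absK N := norm_is_seminorm hN.

Lemma direction_bounded : absmx_bounded absK [set B | B \in V /\ N B <= 1].
Proof.
have [C C0 hC] := norm_lower_bound KT hN; exists C => // B [_ NB].
by apply: le_trans (hC B) _; rewrite ler_piMr ?(ltW C0).
Qed.

Lemma perturbed_mem e A : M A -> P e A.
Proof.
move=> MA; exists A => //; exists 0; last by rewrite scaler0 addr0.
by split; [exact: mem0v | rewrite (seminorm0 KT sN)].
Qed.

Lemma perturbed_neq0 e : P e !=set0.
Proof. by have [A MA] := M0; exists A; exact: perturbed_mem. Qed.

Lemma perturbed_bounded e : absmx_bounded absK (P e).
Proof.
have [C C0 hC] := Mb; have [D D0 hD] := direction_bounded.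
exists (C + `|e| * D) => [|_ [A MA [B VB <-]]].
  by rewrite ltr_wpDr// mulr_ge0// ltW.
apply: le_trans (seminormD (absmx_seminorm KT d d) _ _) _.
rewrite (seminormZ (absmx_seminorm KT d d)) (abs_iota KT).
by rewrite lerD ?hC// ler_wpM2l ?hD.
Qed.

Lemma perturbed_subset e e' : 0 <= e -> e <= e' -> P e `<=` P e'.
Proof.
move=> e0 ee' _ [A MA [B [VB NB] <-]].
have [e'0|e'0] := eqVneq e' 0.
  have -> : e = e' by apply/eqP; rewrite eq_le ee' e'0.
  by exists A => //; exists B.
have {}e'0 : 0 < e' by rewrite lt_neqAle eq_sym e'0 (le_trans e0).
exists A => //; exists (iota (e / e') *: B).
  split; first exact: memvZ.
  rewrite (seminormZ sN) (abs_iota KT) ger0_norm ?divr_ge0 ?(ltW e'0)//.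
  rewrite -[leRHS]mulr1; apply: ler_pM; rewrite ?divr_ge0 ?(seminorm_ge0 sN)//.
    exact: ltW.
  by rewrite ler_pdivrMr// mul1r.
by rewrite scalerA -(iotaM KT) mulrCA mulfV ?mulr1// gt_eqF.
Qed.

Lemma growth_bound_subset (N1 N2 : set 'M[K]_d) l : N1 `<=` N2 ->
  growth_bound absK N2 l -> growth_bound absK N1 l.
Proof.
by move=> sub [l0 [w hw hl]]; split=> //; exists w => // A /sub; exact: hl.
Qed.

Lemma perturbed_growth e l : r e < l -> growth_bound absK (P e) l.
Proof. exact: (jsr_lt KT hnu (perturbed_neq0 e) (perturbed_bounded e)). Qed.

Lemma perturbed_jsr_le e l : growth_bound absK (P e) l -> r e <= l.
Proof. exact: (jsr_le KT hnu (perturbed_neq0 e) (perturbed_bounded e)). Qed.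

Lemma perturbed_jsr_ge0 e : 0 <= r e.
Proof. exact: (jsr_ge0 KT hnu (perturbed_neq0 e) (perturbed_bounded e)). Qed.

Lemma perturbed_jsr_mono e e' : 0 <= e -> e <= e' -> r e <= r e'.
Proof.
move=> e0 ee'; apply/ler_addgt0Pr => h h0; apply: perturbed_jsr_le.
apply: growth_bound_subset (perturbed_subset e0 ee') _.
by apply: perturbed_growth; rewrite ltrDl.
Qed.

(** Because A + e' B = (A + e B) + (e' - e) B, it suffices to measure the
    directions B in a norm suited to P e. *)
Lemma perturbed_shift e e' l b (w : 'cV[K]_d -> R) :
  0 <= l -> 0 <= b -> e <= e' -> is_norm absK w ->
  (forall A, P e A -> forall x, w (A *m x) <= l * w x) ->
  (forall B, B \in V -> N B <= 1 -> forall x, w (B *m x) <= b * w x) ->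
  r e' <= l + (e' - e) * b.
Proof.
move=> l0 b0 ee' hw cw cB; have sw := norm_is_seminorm hw.
have ee0 : 0 <= e' - e by rewrite subr_ge0.
apply: perturbed_jsr_le; split; first by rewrite addr_ge0// mulr_ge0.
exists w => // _ [A MA [B [VB NB] <-]] x.
have -> : (A + iota e' *: B) *m x =
    (A + iota e *: B) *m x + iota (e' - e) *: (B *m x).
  rewrite !mulmxDl -!scalemxAl -addrA -scalerDl (iotaB KT).
  by rewrite [iota e + _]addrC subrK.
apply: le_trans (seminormD sw _ _) _.
rewrite (seminormZ sw) (abs_iota KT) (ger0_norm ee0).
rewrite [leRHS]mulrDl -[_ * b * _]mulrA.
rewrite lerD ?ler_wpM2l ?cB// cw//.
by exists A => //; exists B.
Qed.

(** Both A + e B and A - e B belong to P e, so by subtraction a norm contracted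
    at rate l by P e satisfies e w(B x) <= l w(x).  In other words, r(e) / e is
    nonincreasing. *)
Lemma perturbed_ratio e e' : 0 < e -> e <= e' ->
  r e' - r e <= (e' - e) / e * r e.
Proof.
move=> e0 ee'.
suff h l : r e < l -> r e' <= l * (e' / e).
  suff : r e' * (e / e') <= r e.
    rewrite mulrA ler_pdivrMr ?(lt_le_trans e0)// => h'.
    rewrite mulrAC ler_pdivlMr// mulrBl mulrBl; move: h'.
    by move: (r e') (r e) => a b; lra.
  apply/ler_addgt0Pr => g g0.
  rewrite -ler_pdivlMr ?divr_gt0 ?(lt_le_trans e0)// invf_div.
  by apply: h; rewrite ltrDl.
move=> /perturbed_growth [l0 [w hw cw]]; have sw := norm_is_seminorm hw.
have -> : l * (e' / e) = l + (e' - e) * (l / e) by field; rewrite gt_eqF.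
apply: (perturbed_shift l0 _ ee' hw cw); first by rewrite divr_ge0 ?(ltW e0).
move=> B VB NB x; have [A MA] := M0.
have h1 : w ((A + iota e *: B) *m x) <= l * w x.
  by apply: cw; exists A => //; exists B.
have h2 : w ((A + iota e *: - B) *m x) <= l * w x.
  apply: cw; exists A => //; exists (- B) => //.
  by split; [rewrite memvN | rewrite (seminormN KT sN)].
have h3 : e * w (B *m x) *+ 2 <= l * w x + l * w x.
  apply: le_trans (lerD h1 h2); apply: le_trans (seminormB KT sw _ _).
  rewrite -mulmxBl opprD addrACA subrr add0r scalerN opprK -scalerDl.
  rewrite -scalemxAl (seminormZ sw) (iota_double KT) (abs_iota KT).
  by rewrite ger0_norm ?mulrn_wge0 ?(ltW e0)// mulrnAl.
rewrite mulrAC ler_pdivlMr// mulrC; move: h3; rewrite mulr2n; lra.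
Qed.

(** ** Upper bounds near 0 and in the irreducible case *)

(** In the norm adapted to the flag, M has rate r(0) + O(eta) and the directions
    have size O(eta / eta^m), which is harmless for e = O(eta^m).  The factor 2
    leaves room for the right end e' of an increment. *)
Lemma jsr_holder_at0 m : reducibility_index M m ->
  exists2 C, 0 < C & forall eta e, 0 < eta -> eta <= 1 -> 0 <= e ->
    e <= 2 * eta ^+ m -> r e <= r 0 + C * eta.
Proof.
move=> [F hF]; have irr := maximal_flag_no_intermediate hF.
have [hflag _] := hF.
have L0 : 0 <= r 0 + 1 by rewrite addr_ge0 ?perturbed_jsr_ge0.
have [C C0 hC] := adapted_norm KT Mb hflag irr L0.
have [D D0 hD] := direction_bounded.
exists (1 + C + 2 * C * D) => [|eta e eta0 eta1 e0 eeta].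
  by rewrite !addr_gt0// !mulr_gt0.
have etam : 0 < eta ^+ m by rewrite exprn_gt0.
have gM : growth_bound absK M (r 0 + eta).
  apply: growth_bound_subset (perturbed_mem 0) _.
  by apply: perturbed_growth; rewrite ltrDl.
have lL : r 0 + eta <= r 0 + 1 by rewrite lerD2l.
have [v hv [cv Bv]] := hC eta (r 0 + eta) eta0 eta1 lL gM.
pose b := C * eta * D / eta ^+ m.
have b0 : 0 <= b by rewrite divr_ge0 ?mulr_ge0 ?ltW.
have l0 : 0 <= r 0 + eta + C * eta.
  by rewrite !addr_ge0 ?perturbed_jsr_ge0 ?mulr_ge0 ?ltW.
apply: le_trans (_ : r 0 + eta + C * eta + (e - 0) * b <= _).
  apply: (perturbed_shift l0 b0 e0 hv) => [_ [A MA [B _ <-]] x|B VB NB x].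
    by rewrite (iota0 KT) scale0r addr0; exact: cv.
  rewrite /b mulrAC ler_pdivlMr//; apply: le_trans (Bv B x) _.
  rewrite ler_wpM2r ?(seminorm_ge0 (norm_is_seminorm hv))//.
  by rewrite ler_wpM2l ?mulr_ge0 ?(ltW C0) ?(ltW eta0)// hD.
have : e * b <= 2 * C * D * eta.
  rewrite /b mulrA ler_pdivrMr//.
  rewrite [leRHS](_ : _ = 2 * eta ^+ m * (C * eta * D)); last by ring.
  by rewrite ler_wpM2r// !mulr_ge0 ?ltW.
rewrite subr0; lra.
Qed.

(** All parameters up to E share the constant of irreducible_norm for
    L = r(E) + 1. *)
Lemma jsr_lipschitz_irreducible E : reducibility_index M 1 -> 0 <= E ->
  exists2 C, 0 < C & forall e e', 0 <= e -> e <= e' -> e' <= E ->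
    r e' - r e <= C * (e' - e).
Proof.
move=> [F hF] E0; have := maximal_flag_no_intermediate hF (ltnSn 0).
have [[F0 F1 _ _] _] := hF; rewrite F0 F1 => irr.
have L0 : 0 <= r E + 1 by rewrite addr_ge0 ?perturbed_jsr_ge0.
have [C C0 hC] := irreducible_norm KT irr L0.
have [D D0 hD] := direction_bounded.
exists (C * D) => [|e e' e0 ee' e'E]; first exact: mulr_gt0.
rewrite lerBlDr addrC; apply/ler_addgt0Pr => h h0.
(* A slack of at most 1 keeps the rate r e + g below r E + 1. *)
pose g := Num.min h 1.
have g0 : 0 < g by rewrite lt_min h0 ltr01.
have [gh g1] : g <= h /\ g <= 1 by split; rewrite ge_min lexx ?orbT.
have /perturbed_growth [l0 [w hw cw]] : r e < r e + g by rewrite ltrDl.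
have cwM : contracts M (r e + g) w.
  by move=> A MA; apply: cw; exact: perturbed_mem.
have lL : r e + g <= r E + 1.
  apply: lerD; last exact: g1.
  by apply: perturbed_jsr_mono e0 _; exact: le_trans ee' e'E.
have CD : 0 <= C * D by rewrite ltW// mulr_gt0.
apply: le_trans (perturbed_shift l0 CD ee' hw cw _) _ => [B VB NB x|].
  apply: le_trans (hC _ w lL hw cwM B x) _.
  rewrite ler_wpM2r ?(seminorm_ge0 (norm_is_seminorm hw))//.
  by rewrite ler_wpM2l ?(ltW C0)// hD.
by rewrite [_ * (C * D)]mulrC addrAC lerD2l.
Qed.

End Perturbation.

(** * Local Hoelder continuity *)

(** Interpolation between the two estimates: either e <= theta^m, and
    e' <= 2 theta^m allows eta = theta at 0, or (e' - e) / e <= theta.  For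
    theta > 1 the monotonicity of r is enough. *)
Lemma holder_of_ratio (R : realType) (r : R -> R) (C : R) m :
  (forall e, 0 <= e -> 0 <= r e) ->
  (forall e e', 0 <= e -> e <= e' -> r e <= r e') ->
  (forall e e', 0 < e -> e <= e' -> r e' - r e <= (e' - e) / e * r e) ->
  0 <= C -> (forall eta e, 0 < eta -> eta <= 1 -> 0 <= e ->
    e <= 2 * eta ^+ m -> r e <= r 0 + C * eta) ->
  forall E e e' theta, 0 <= e -> e <= e' -> e' <= E -> 0 < theta ->
    theta ^+ m.+1 = e' - e -> r e' - r e <= (C + r E) * theta.
Proof.
move=> r_ge0 r_mono r_ratio C0 r_at0 E e e' th e0 ee' e'E th0 thE.
have e'0 : 0 <= e' := le_trans e0 ee'.
have rE0 : 0 <= r E by apply: r_ge0; exact: le_trans e'E.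
have re0 := r_ge0 e e0.
have rr0 := r_mono 0 e (lexx 0) e0.
have rr' := r_mono e' E e'0 e'E.
have rr := r_mono e E e0 (le_trans ee' e'E).
have Cth : 0 <= C * th by rewrite mulr_ge0// ltW.
have rth : 0 <= r E * th by rewrite mulr_ge0// ltW.
have [th1|th1] := leP th 1; last first.
  have : r E <= r E * th by rewrite ler_peMr// ltW.
  by rewrite mulrDl; lra.
have thm : 0 < th ^+ m by rewrite exprn_gt0.
have [eth|eth] := leP e (th ^+ m).
  have : r e' <= r 0 + C * th.
    apply: r_at0 => //.
    (* e' = e + theta^(m+1) <= 2 theta^m *)
    have : th ^+ m.+1 <= th ^+ m by rewrite exprS ler_piMl// ltW.
    by move: thE eth; lra.
  by rewrite mulrDl; lra.
have ep : 0 < e by exact: lt_trans eth.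
have h1 := r_ratio e e' ep ee'.
have h2 : (e' - e) / e * r e <= th * r E.
  apply: ler_pM => //; first by rewrite divr_ge0// subr_ge0.
  by rewrite ler_pdivrMr// -thE exprS ler_wpM2l ?ltW.
by rewrite mulrDl [r E * _]mulrC; lra.
Qed.

(** A compact subset of the half-line lies in some [0, E]. *)
Lemma locally_holder_halfline (R : realType) (alpha : R) (f : R^o -> R^o) :
  (forall E, 0 <= E -> exists C, forall x y, 0 <= x -> x < y -> y <= E ->
     `|f y - f x| <= C * (y - x) `^ alpha) ->
  locally_holder (`[0, +oo[ : set R^o) alpha f.
Proof.
move=> hf S Sc S0.
have [E E0 hE] : exists2 E, 0 <= E & forall x, S x -> x <= E.
  have [B [_ hB]] := compact_bounded Sc.
  exists (`|B| + 1) => [|x Sx]; first by rewrite addr_ge0.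
  apply: le_trans (ler_norm x) _; apply: hB => //.
  by rewrite (le_lt_trans (ler_norm B))// ltrDl.
have [C hC] := hf E E0.
apply: (@le_lt_trans _ _ C%:E); last exact: ltry.
apply: ge_ereal_sup => _ [[x y] /= [Sx Sy xy] <-]; rewrite lee_fin.
have pos z : S z -> 0 <= z by move=> /S0; rewrite /= in_itv /= andbT.
have md (a b : R^o) : mdist a b = `|b - a| by [].
rewrite !md.
wlog lxy : x y Sx Sy xy / x < y.
  move=> wl; have [lt|gt|eq] := ltgtP x y; first exact: wl.
    by rewrite distrC [X in _ / X `^ _]distrC; apply: wl => //; rewrite eq_sym.
  by rewrite eq eqxx in xy.
rewrite ler_pdivrMr; last by rewrite powR_gt0// normr_gt0 subr_eq0 eq_sym.
rewrite [X in _ * X `^ _]gtr0_norm; last by rewrite subr_gt0.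
by apply: hC => //; [exact: pos | exact: hE].
Qed.

Theorem theorem16 (R : realType) (K : numFieldType)
    (iota : R -> K) (absK : K -> R) (hK : real_or_complex iota absK)
    (d : nat) (hd : (1 <= d)%N)
    (nu : 'cV[K]_d -> R) (hnu : is_norm absK nu)
    (M : set 'M[K]_d) (hM0 : M !=set0) (hMc : compact M)
    (m : nat) (hm : (1 <= m)%N) (hMm : reducibility_index M m)
    (V : {vspace 'M[K]_d})
    (N : 'M[K]_d -> R) (hN : is_norm absK N) :
  let r : R^o -> R^o := fun eps : R =>
    joint_spectral_radius nu (perturbed iota M V N eps) in
  ((2 <= m)%N -> locally_holder (`[0, +oo[ : set R^o) (m.+1%:R^-1) r) /\
  (m = 1%N -> locally_lipschitz (`[0, +oo[ : set R^o) r).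
Proof.
have KT := scalar_theoryP hK; have Mb := compact_absmx_bounded KT hMc.
have mono := perturbed_jsr_mono KT hnu hM0 Mb V hN.
move=> r; split=> [_|m1]; apply: locally_holder_halfline => E E0.
  have [C C0 hC] := jsr_holder_at0 KT hnu hM0 Mb V hN hMm.
  have ge0 e : 0 <= e -> 0 <= r e.
    by move=> _; exact: (perturbed_jsr_ge0 KT hnu hM0 Mb V hN).
  have ratio := perturbed_ratio KT hnu hM0 Mb V hN.
  have hr := holder_of_ratio ge0 mono ratio (ltW C0) hC.
  exists (C + r E) => x y x0 xy yE.
  rewrite ger0_norm; last by rewrite subr_ge0; exact: mono x0 (ltW xy).
  (* theta is the (m+1)-st root of y - x. *)
  apply: hr x0 (ltW xy) yE _ _; first by apply: powR_gt0; rewrite subr_gt0.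
  by rewrite -powR_mulrn ?powR_ge0// -powRrM mulVf// powRr1// subr_ge0 ltW.
rewrite m1 in hMm.
have [C C0 hC] := jsr_lipschitz_irreducible KT hnu hM0 Mb V hN hMm E0.
exists C => x y x0 xy yE.
rewrite ger0_norm; last by rewrite subr_ge0; exact: mono x0 (ltW xy).
rewrite powRr1; last by rewrite subr_ge0 ltW.
exact: hC x0 (ltW xy) yE.
Qed.
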